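(* Let $B$ be a real $N\times N$ matrix such that $\sup_{t\in\mathbb{R}}\|\exp(-tB)\|<\infty$, and let $\mathscr{L}=\Delta+\langle Bx,\nabla\rangle-\partial_t$ on $\mathbb{R}^{N+1}=\mathbb{R}^N_x\times\mathbb{R}_t$. There exists a positive constant $C$ such that, for every $z_0\in\mathbb{R}^{N+1}$ and every non-negative smooth solution $u$ to $\mathscr{L}u=0$ in $\mathbb{R}^{N+1}$, $$u(z)\le C\,u(z_0)\qquad\text{for every }z\in P(z_0)$$ (that is, $C$ is independent of $u$ and $z_0$).
   Context: $\Delta$, $\nabla$ and $\langle\cdot,\cdot\rangle$ are the Laplace operator, the gradient and the inner product in $\mathbb{R}^N$ (acting in the variable $x$), so $\mathscr{L}u(x,t)=\Delta_x u(x,t)+\langle Bx,\nabla_x u(x,t)\rangle-\partial_t u(x,t)$. $\|\cdot\|$ is the operator norm. Smooth means $C^\infty$. Let $E(t)=\exp(-tB)$. On $\mathbb{R}^{N+1}$ consider the Lie group composition law $$(x,t)\circ(y,\tau)=(y+E(\tau)x,\;t+\tau).$$ Let $P=\{(x,t)\in\mathbb{R}^{N+1}: t<-|x|^2/4\}$ and, for $z_0\in\mathbb{R}^{N+1}$, $P(z_0)=z_0\circ P=\{z_0\circ\zeta:\zeta\in P\}$. *)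

(* Defs.v *)
From HB Require Import structures.
From mathcomp Require Import all_boot all_order all_algebra.
From mathcomp Require Import all_classical all_reals all_analysis.
Import Order.TTheory GRing.Theory Num.Theory.
Import numFieldNormedType.Exports.
Set Implicit Arguments.
Unset Strict Implicit.
Unset Printing Implicit Defensive.
Local Open Scope classical_set_scope.
Local Open Scope ring_scope.

Definition dotp (R : realType) (N : nat) (x y : 'cV[R]_N) : R :=
  \sum_i x i 0 * y i 0.

(* The library norm on matrices is the entrywise maximum, hence the explicit
   Euclidean norm and the operator norm it induces. *)
Definition enorm (R : realType) (N : nat) (x : 'cV[R]_N) : R :=
  Num.sqrt (dotp x x).

Definition opnorm (R : realType) (N : nat) (A : 'M[R]_N) : R :=
  sup [set enorm (A *m x) | x in [set x : 'cV[R]_N | enorm x <= 1]].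

Definition expmx (R : realType) (N : nat) (A : 'M[R]_N) : 'M[R]_N :=
  limn (series (fun k : nat => (k`!%:R : R)^-1 *: A ^+ k)).

Definition E (R : realType) (N : nat) (B : 'M[R]_N) (t : R) : 'M[R]_N :=
  expmx (- t *: B).

(* A point of R^(N+1) is a pair (x, t) : 'cV[R]_N * R. *)
Definition dirx (R : realType) (N : nat) (i : 'I_N) : 'cV[R]_N * R :=
  (delta_mx i 0, 0).

Definition dirt (R : realType) (N : nat) : 'cV[R]_N * R := (0, 1).

(* None is the time coordinate, Some i the i-th space coordinate. *)
Definition dir (R : realType) (N : nat) (j : option 'I_N) : 'cV[R]_N * R :=
  if j is Some i then dirx R i else dirt R N.

(* All partial derivatives of order at most k exist and are continuous. *)
Fixpoint Ck (R : realType) (N : nat) (k : nat) (u : 'cV[R]_N * R -> R) : Prop :=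
  continuous u /\
  if k is k'.+1 then
    forall j : option 'I_N,
      (forall z, derivable u z (dir R j)) /\ Ck k' ('D_(dir R j) u)
  else True.

Definition smooth (R : realType) (N : nat) (u : 'cV[R]_N * R -> R) : Prop :=
  forall k : nat, Ck k u.

Definition gradx (R : realType) (N : nat) (u : 'cV[R]_N * R -> R)
    (z : 'cV[R]_N * R) : 'cV[R]_N :=
  \col_i 'D_(dirx R i) u z.

Definition laplx (R : realType) (N : nat) (u : 'cV[R]_N * R -> R)
    (z : 'cV[R]_N * R) : R :=
  \sum_(i < N) 'D_(dirx R i) ('D_(dirx R i) u) z.

Definition opL (R : realType) (N : nat) (B : 'M[R]_N) (u : 'cV[R]_N * R -> R)
    (z : 'cV[R]_N * R) : R :=
  laplx u z + dotp (B *m z.1) (gradx u z) - 'D_(dirt R N) u z.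

Definition group_law (R : realType) (N : nat) (B : 'M[R]_N)
    (z w : 'cV[R]_N * R) : 'cV[R]_N * R :=
  (w.1 + E B w.2 *m z.1, z.2 + w.2).

Definition P (R : realType) (N : nat) : set ('cV[R]_N * R) :=
  [set z | z.2 < - (enorm z.1 ^+ 2 / 4)].

Definition P_at (R : realType) (N : nat) (B : 'M[R]_N) (z0 : 'cV[R]_N * R) :
    set ('cV[R]_N * R) :=
  [set group_law B z0 w | w in @P R N].

(* Main.v *)
Require Import Defs.
From mathcomp Require Import all_boot all_order all_algebra.
From mathcomp Require Import all_classical all_reals all_analysis.
From mathcomp Require Import ring lra.
Import Order.TTheory GRing.Theory Num.Theory.
Import numFieldNormedType.Exports.
Set Implicit Arguments.
Unset Strict Implicit.
Unset Printing Implicit Defensive.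
Local Open Scope classical_set_scope.
Local Open Scope ring_scope.

(** The hypothesis bounds both the flow
    E(t) and its inverse E(-t), so that in the coordinates E(-t) x carried by
    the flow the equation has no drift any more, and becomes a parabolic
    equation whose coefficients depend on time only and are uniformly elliptic
    for all times.  A solution that is defined for all past times and is positive
    can then be studied on larger and larger cylinders, and the error term of a
    Li-Yau type gradient estimate disappears in the limit.

    The estimate is made for f = ln u, which solves
      transport f = Lap f + |grad f|^2,   transport = d_t - <B x, grad>.
    The usual Li-Yau quantity involves d_t f; differentiating the equation in
    time would produce derivatives of the coefficients, which do not become
    small on large scales.  Instead, fix a time t1, let D_k be the derivative
    along the vector E(t - t1) e_k, and consider
      liyau = sum_k D_k D_k f + (D_k f)^2 / 2.
    The D_k commute with transport and with the space derivatives, so the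
    linearised operator log_op annihilates each D_k f, and log_op_liyau gives
      log_op liyau = - sum_(k, i) (d_i D_k f)^2,
    in which no derivative of the frame appears.  The right-hand side is at most
    - (liyau - |D f|^2 / 2)^2 up to a constant factor.  At a negative interior
    minimum of cutoff * liyau on a cylinder of radius r, this quadratic term
    competes with the derivatives of the cut-off function; liyau_at_min concludes
    that the minimum is at least - 82 m^4 r^4, where m bounds the squared
    Frobenius norm of all E(t).  The cut-off function equals r^6 at the centre, so
    r -> +oo yields liyau >= 0 there.  At the time t1 the frame is the canonical
    basis, hence log_laplacian_ge:
      Lap f + |grad f|^2 / 2 >= 0 everywhere.

    This inequality is integrated in log_harnack.  Along a curve (c(s), s) with
    c' = - B c + w, the derivative of f is
      transport f + <w, grad f> >= |grad f|^2 / 2 + <w, grad f> >= - |w|^2 / 2.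
    The curve that is a straight segment in the coordinates carried by the flow
    joins a point of P(z0) to z0 with |w|^2 / 2 <= m^2 |y|^2 / (2 tau^2), and the
    integral over a time -tau is at most 2 m^2 because |y|^2 < - 4 tau on P.
    This gives the constant exp(2 m^2).

    A non-negative u may vanish, so that all this is applied to u + d, which is
    again a solution for every constant d > 0, before d tends to 0. *)

(** * Directional derivatives in a normed space *)

Section directional.
Context {R : realType} {V : normedModType R}.
Implicit Types (f g : V -> R) (v w x y : V).

(** Reduces derivatives in a direction to derivatives of functions of a real
    variable, for which the mean value theorem and the chain rule are available. *)
Lemma is_derive_line f v x (s df : R) :
  is_derive (s *: v + x) v f df <-> is_derive s 1 (fun h : R => f (h *: v + x)) df.
Proof.
have e : (fun h : R => h^-1 *: ((f \o shift (s *: v + x)) (h *: v) - f (s *: v + x)))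
   = (fun h : R => h^-1 *: (((fun h : R => f (h *: v + x)) \o shift s) (h *: 1)
       - f (s *: v + x))).
  apply/funext => h /=; congr (_ *: (f _ - _)).
  by rewrite [h%:A]mulr1 scalerDl addrA.
split=> -[H1 H2]; split.
- by rewrite /derivable -e.
- by rewrite /derive -e.
- by rewrite /derivable e.
- by rewrite /derive e.
Qed.

Lemma derivable_line f v x : (forall z, derivable f z v) ->
  forall s : R, is_derive s 1 (fun h : R => f (h *: v + x)) ('D_v f (s *: v + x)).
Proof. by move=> df s; apply/is_derive_line/derivableP. Qed.

Lemma mvt_dir f v x (h : R) : (forall z, derivable f z v) ->
  exists2 th : R, `|th| <= `|h| & f (h *: v + x) - f x = h * 'D_v f (th *: v + x).
Proof.
move=> df.
have dl := derivable_line x df.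
have cont a b : {within `[a, b], continuous (fun h : R => f (h *: v + x))}.
  apply: derivable_within_continuous => t _.
  by have [] := dl t.
have [h0|h0] := leP 0 h.
  have [c] := MVT_segment h0 (fun t _ => dl t) (cont _ _).
  rewrite in_itv/= scale0r add0r subr0 => /andP[c0 ch] ->.
  by exists c; [rewrite !ger0_norm// | rewrite mulrC].
have [c] := MVT_segment (ltW h0) (fun t _ => dl t) (cont _ _).
rewrite in_itv/= scale0r add0r sub0r => /andP[hc c0] e.
exists c; first by rewrite !ler0_norm ?lerN2// ltW.
by rewrite -opprB e mulrN opprK mulrC.
Qed.

(** Schwarz' theorem: the mixed second difference of f on a parallelogram with
    sides h v and h w is symmetric in v and w, and two applications of the mean
    value theorem write it as h^2 times either mixed derivative at a point at
    distance O(h). *)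
Lemma derive_comm f v w :
  (forall z, derivable f z v) -> (forall z, derivable f z w) ->
  (forall z, derivable ('D_v f) z w) -> (forall z, derivable ('D_w f) z v) ->
  continuous ('D_w ('D_v f)) -> continuous ('D_v ('D_w f)) ->
  'D_w ('D_v f) = 'D_v ('D_w f).
Proof.
have half (g : V -> R) (a b : V) : (forall z, derivable g z a) ->
    (forall z, derivable ('D_a g) z b) -> forall z (h : R), exists s t : R,
    [/\ `|s| <= `|h|, `|t| <= `|h| &
    g (h *: a + (h *: b + z)) - g (h *: a + z) - g (h *: b + z) + g z =
    h * (h * 'D_b ('D_a g) (t *: b + (s *: a + z)))].
  move=> da dba z h.
  pose G y := g (h *: b + y) - g y.
  have dG y : is_derive y a G ('D_a g (h *: b + y) - 'D_a g y).
    have d1 : is_derive y a (fun y => g (h *: b + y)) ('D_a g (h *: b + y)).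
      rewrite -[X in is_derive X](add0r y) -(scale0r a).
      apply/is_derive_line.
      have -> : (fun h0 : R => g (h *: b + (h0 *: a + y))) =
         (fun h0 : R => g (h0 *: a + (h *: b + y))).
        by apply/funext => k; rewrite addrCA.
      apply/is_derive_line; rewrite scale0r add0r.
      exact/derivableP.
    have d2 := derivableP (da y).
    exact: is_deriveB.
  have [|s sh E1] := @mvt_dir G a z h; first by move=> y; have [] := dG y.
  have [t th E2] := mvt_dir (s *: a + z) h dba.
  exists s, t; split => //.
  move: E1; rewrite (@derive_val _ _ _ _ _ _ _ (dG (s *: a + z))) E2 => <-.
  by rewrite /G addrCA opprB addrA addrAC; ring.
move=> dv dw dvw dwv cvw cwv; apply/funext => z.
have [//|/eqP ne] := pselect ('D_w ('D_v f) z = 'D_v ('D_w f) z).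
have far (a b m : R) : `|a - m| < `|a - b| / 2 -> `|b - m| < `|a - b| / 2 -> False.
  move=> K1; rewrite distrC => K2; have := ltrD K1 K2; rewrite -splitr.
  by rewrite ltNge ler_distD.
pose e : R := `|('D_w ('D_v f) z : R) - 'D_v ('D_w f) z| / 2.
have e0 : 0 < e by rewrite divr_gt0// normr_gt0 subr_eq0.
have near (g : V -> R) : {for z, continuous g} -> exists2 d : R, 0 < d &
   forall y, `|z - y| < d -> `|g z - g y| < e.
  move=> /cvgrPdist_lt /(_ e e0) /nbhs_ballP[d /= d0 H].
  by exists d => // y yd; apply: H; rewrite -ball_normE.
have [d1 d10 H1] := near _ (cvw z).
have [d2 d20 H2] := near _ (cwv z).
pose n := `|v| + `|w| + 1.
have n0 : 0 < n by rewrite ltr_wpDl// addr_ge0.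
pose h := Num.min d1 d2 / (2 * n).
have h0 : 0 < h by rewrite divr_gt0 ?mulr_gt0// lt_min d10.
have small (a b : R) : `|a| <= `|h| -> `|b| <= `|h| ->
   `|z - (b *: w + (a *: v + z))| < Num.min d1 d2.
  move=> ah bh; rewrite addrA opprD addrCA subrr addr0 normrN.
  apply: (le_lt_trans (ler_normD _ _)); rewrite !normrZ.
  rewrite (gtr0_norm h0) in ah bh.
  have -> : Num.min d1 d2 = h * (2 * n) by rewrite /h divfK// gt_eqF// mulr_gt0.
  apply: (@le_lt_trans _ _ (h * n)).
    rewrite /n !mulrDr mulr1.
    have := ler_wpM2r (normr_ge0 w) bh; have := ler_wpM2r (normr_ge0 v) ah.
    by move=> *; rewrite -[leLHS]addr0 [in leLHS](addrC (`|b| * _)) lerD ?lerD// ltW.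
  by rewrite ltr_pM2l// ltr_pMl ?ltr1n.
have [s [t [sh th E1]]] := half f v w dv dvw z h.
have [s' [t' [sh' th' E2]]] := half f w v dw dwv z h.
have EE : 'D_w ('D_v f) (t *: w + (s *: v + z)) = 'D_v ('D_w f) (t' *: v + (s' *: w + z)).
  apply: (mulfI (lt0r_neq0 h0)); apply: (mulfI (lt0r_neq0 h0)).
  apply: etrans (esym E1) _; apply: etrans E2.
  rewrite (addrCA (h *: w)); congr (_ + _).
  exact: addrAC.
have lt1 : Num.min d1 d2 <= d1 by rewrite ge_min lexx.
have lt2 : Num.min d1 d2 <= d2 by rewrite ge_min lexx orbT.
have small' : `|z - (t' *: v + (s' *: w + z))| < Num.min d1 d2.
  by rewrite (addrCA (t' *: v)); exact: small.
have K1 := H1 _ (lt_le_trans (small _ _ sh th) lt1).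
have K2 := H2 _ (lt_le_trans small' lt2).
rewrite EE in K1.
by case: (far _ _ _ K1 K2).
Qed.

(** First-order expansion in several directions at once, which is what the chain
    rule needs: move in one direction after the other, use the mean value theorem
    for each step, and compare the derivative there with the one at z. *)
Lemma C1_expansion f z (I : eqType) (dr : I -> V) (s : seq I) (e : R) :
  (forall i x, derivable f x (dr i)) -> (forall i, continuous ('D_(dr i) f)) ->
  0 < e ->
  exists2 d : R, 0 < d & forall c : I -> R, (forall i, `|c i| <= d) ->
   `|f (\sum_(i <- s) c i *: dr i + z) - f z - \sum_(i <- s) c i * 'D_(dr i) f z|
     <= e * \sum_(i <- s) `|c i|.
Proof.
move=> df cf e0; elim: s => [|j s [d d0 IH]].
  by exists 1 => // c _; rewrite !big_nil add0r subrr subr0 normr0 mulr0.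
have /cvgrPdist_lt /(_ e e0) /nbhs_ballP[d1 /= d10 H] := cf j z.
pose n := \sum_(i <- j :: s) `|dr i| + 1.
have n0 : 0 < n by rewrite ltr_wpDl// sumr_ge0.
pose d' := Num.min d (d1 / (2 * n)).
have d'0 : 0 < d' by rewrite lt_min d0 divr_gt0// mulr_gt0.
exists d' => // c cd.
rewrite !big_cons.
set S := \sum_(i <- s) c i *: dr i; set Z := \sum_(i <- s) _ * _.
have [th thc E] := mvt_dir (S + z) (c j) (df j).
have -> : c j *: dr j + S + z = c j *: dr j + (S + z) by rewrite addrA.
have -> : f (c j *: dr j + (S + z)) - f z - (c j * 'D_(dr j) f z + Z) =
  (f (c j *: dr j + (S + z)) - f (S + z) - c j * 'D_(dr j) f z) +
  (f (S + z) - f z - Z) by ring.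
rewrite E -mulrBr [leRHS]mulrDr; apply: (le_trans (ler_normD _ _)); apply: lerD; last first.
  by apply: IH => i; apply: le_trans (cd i) _; rewrite ge_min lexx.
rewrite normrM mulrC; apply: ler_wpM2r => //; rewrite distrC ltW//; apply: H.
rewrite -ball_normE/= distrC addrA addrK.
apply: (@le_lt_trans _ _ (d' * n)); last first.
  rewrite -ltr_pdivlMr//; apply: (@le_lt_trans _ _ (d1 / (2 * n))).
    by rewrite ge_min lexx orbT.
  by rewrite ltr_pM2l// ltf_pV2 ?posrE ?mulr_gt0// ltr_pMl// ltr1n.
rewrite /n big_cons !mulrDr mulr1; apply: le_trans (ler_normD _ _) _.
rewrite -[leLHS]addr0; apply: lerD (ltW d'0); apply: lerD.
  by rewrite normrZ ler_wpM2r// (le_trans thc).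
rewrite mulr_sumr; apply: le_trans (ler_norm_sum _ _ _) _.
by apply: ler_sum => i _; rewrite normrZ ler_wpM2r.
Qed.

End directional.

(** * Partial derivatives and the chain rule along a curve *)

Definition partial (R : realType) (N : nat) (j : option 'I_N) (f : 'cV[R]_N * R -> R) :
  'cV[R]_N * R -> R := fun z => 'D_(dir R j) f z.

Notation "''d_' j f" := (partial j f)
  (at level 10, j at next level, f at next level, format "''d_' j  f").

Section smooth_functions.
Context {R : realType} {N : nat}.
Local Notation T := ('cV[R]_N * R)%type.
Implicit Types (f g : T -> R) (z : T) (j : option 'I_N).

Lemma is_derive_curve f (x : R -> 'cV[R]_N) (dx : 'cV[R]_N) (s : R) :
  (forall j z, derivable f z (dir R j)) -> (forall j, continuous ('d_j f)) ->
  (forall i, is_derive s 1 (fun r => x r i 0) (dx i 0)) ->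
  is_derive s 1 (fun r => f (x r, r))
    ('d_None f (x s, s) + \sum_i dx i 0 * 'd_(Some i) f (x s, s)).
Proof.
move=> df cf dx_.
set L := (X in is_derive _ _ _ X).
pose dr := @dir R N.
(* the increment of the curve, and its derivative, in the directions dr *)
pose c h j := if j is Some i then x (h + s) i 0 - x s i 0 else h.
pose c' j := if j is Some i then dx i 0 else 1.
pose J := None :: map Some (enum 'I_N).
have sumJ (F : option 'I_N -> R) : \sum_(j <- J) F j = F None + \sum_i F (Some i).
  by rewrite big_cons big_map big_enum.
have decomp h : (x (h + s), h + s) = \sum_(j <- J) c h j *: dr j + (x s, s) :> T.
  rewrite big_cons big_map big_enum /=.
  have -> : \sum_(i in 'I_N) (x (h + s) i 0 - x s i 0) *: dirx R i =
     (x (h + s) - x s, 0) :> T.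
    apply: injective_projections; last first.
      by rewrite (big_morph (fun z : T => z.2) (id1 := 0) (op1 := +%R))//
         big1// => i _; rewrite /= scaler0.
    rewrite (big_morph (fun z : T => z.1) (id1 := 0) (op1 := +%R))//.
    apply/matrixP => i k; rewrite ord1 summxE (bigD1 i)//= big1 => [|l li].
      by rewrite !mxE !eqxx mulr1 addr0.
    by rewrite !mxE eq_sym (negbTE li) mulr0.
  apply: injective_projections => /=.
    by rewrite scaler0 add0r subrK.
  by rewrite [_%:A]mulr1 addr0.
have cq j : (fun h => h^-1 * c h j) @ 0^' --> c' j.
  case: j => [i|] /=.
    have [/= H <-] := dx_ i.
    move: H; rewrite /derivable /derive /=; set F := (X in cvg (X @ _)) => H.
    have -> : (fun h => h^-1 * (x (h + s) i 0 - x s i 0)) = F.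
      by apply/funext => h; rewrite /F [h%:A]mulr1.
    exact: H.
  apply: cvg_near_cst; rewrite near_withinE; apply: nearW => h h0.
  by rewrite /c' mulVf.
have c0 j : (fun h => c h j) @ 0^' --> (0 : R).
  have H : (fun h : R => h * (h^-1 * c h j)) @ 0^' --> 0 * c' j.
    apply: cvgM; last exact: cq.
    have : {for 0, continuous (fun h : R => h)} by exact: id.
    by move/continuous_withinNx.
  have E : {near 0^', (fun h : R => h * (h^-1 * c h j)) =1 (fun h => c h j)}.
    by rewrite near_withinE; apply: nearW => h h0; rewrite mulVKf.
  by rewrite mul0r in H; exact: cvg_trans (near_eq_cvg E) H.
have cvgsum (F : option 'I_N -> R -> R) (l : option 'I_N -> R) (K : seq (option 'I_N)) :
    (forall j, F j h @[h --> 0^'] --> l j) ->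
    \sum_(j <- K) F j h @[h --> 0^'] --> \sum_(j <- K) l j.
  move=> FL; elim: K => [|j K IH].
    by rewrite big_nil; under eq_cvg do rewrite big_nil; exact: cvg_cst.
  by rewrite big_cons; under eq_cvg do rewrite big_cons; exact: cvgD.
have main : h^-1 *: (f (x (h + s), h + s) - f (x s, s)) @[h --> 0^'] --> L.
  have S1 : \sum_(j <- J) (h^-1 * c h j) * 'd_j f (x s, s) @[h --> 0^'] --> L.
    have -> : L = \sum_(j <- J) c' j * 'd_j f (x s, s).
      by rewrite sumJ mul1r.
    by apply: cvgsum => j; apply: cvgM; [exact: cq | exact: cvg_cst].
  have S2 : \sum_(j <- J) `|h^-1 * c h j| @[h --> 0^'] --> \sum_(j <- J) `|c' j|.
    by apply: cvgsum => j; apply: cvg_norm; exact: cq.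
  rewrite -[L]addr0.
  have -> : (fun h : R => h^-1 *: (f (x (h + s), h + s) - f (x s, s))) =
     (fun h : R => \sum_(j <- J) (h^-1 * c h j) * 'd_j f (x s, s) +
        h^-1 * (f (x (h + s), h + s) - f (x s, s) - \sum_(j <- J) c h j * 'd_j f (x s, s))).
    apply/funext => h; rewrite mulrBr mulr_sumr.
    rewrite (eq_bigr (fun j => h^-1 * (c h j * 'd_j f (x s, s)))); last first.
      by move=> j _; rewrite mulrA.
    by rewrite [RHS]addrC subrK.
  apply: cvgD S1 _.
  pose S := \sum_(j <- J) `|c' j|.
  have S0 : 0 <= S by apply: sumr_ge0.
  apply/cvgrPdist_le => e e0.
  have e1 : 0 < e / (S + 1) by rewrite divr_gt0// ltr_wpDl.
  have [d d0 H] := C1_expansion (x s, s) J (fun i x => df i x) cf e1.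
  have N1 : \forall h \near 0^', forall j, `|c h j| <= d.
    have : \forall h \near 0^', forall j, j \in [set: option 'I_N]%SET -> `|c h j| <= d.
      apply: filter_forall => j /=.
      have := c0 j; move/cvgrPdist_le => /(_ d d0).
      by apply: filterS => h; rewrite sub0r normrN.
    by apply: filterS => h K j; apply: K; rewrite inE.
  have N2 : \forall h \near 0^', \sum_(j <- J) `|h^-1 * c h j| <= S + 1.
    have := S2; move/cvgrPdist_le => /(_ 1 ltr01).
    by apply: filterS => h; rewrite distrC => /ler_normlP[_]; rewrite lerBlDl.
  apply: filterS2 N1 N2 => h N1 N2.
  rewrite sub0r normrN normrM decomp.
  apply: le_trans (ler_wpM2l (normr_ge0 _) (H _ N1)) _.
  rewrite mulrCA -ler_pdivlMl// invf_div divfK ?gt_eqF// mulr_sumr.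
  under eq_bigr do rewrite -normrM.
  exact: N2.
have main' : h^-1 *: (((fun r => f (x r, r)) \o shift s) (h *: 1) - f (x s, s)) @[h --> 0^'] --> L.
  by under eq_cvg do rewrite /= [_%:A]mulr1; exact: main.
split; first by apply/cvg_ex; exists L.
exact: cvg_lim main'.
Qed.

End smooth_functions.

(** * The algebra of smooth functions *)

Section smooth_algebra.
Context {R : realType} {N : nat}.
Local Notation T := ('cV[R]_N * R)%type.
Implicit Types (f g : T -> R) (z : T) (i j : option 'I_N).

Lemma Ck_continuous k f : Ck k f -> continuous f.
Proof. by case: k => [|k] []. Qed.

Lemma CkS k f : continuous f -> (forall j z, derivable f z (dir R j)) ->
  (forall j, Ck k ('d_j f)) -> Ck k.+1 f.
Proof. by move=> cf df Cf; split=> // j; split; [exact: df|exact: Cf]. Qed.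

Lemma CkW k f : Ck k.+1 f -> Ck k f.
Proof.
elim: k f => [|k IH] f [cf H]; split=> // j.
by have [df /IH] := H j.
Qed.

Lemma smooth_derivable f : smooth f -> forall j z, derivable f z (dir R j).
Proof. by move=> /(_ 1)[_ H] j z; have [] := H j. Qed.

Lemma smooth_continuous f : smooth f -> continuous f.
Proof. by move=> /(_ 0)/Ck_continuous. Qed.

Lemma smooth_d f j : smooth f -> smooth ('d_j f).
Proof. by move=> sf k; have [_ /(_ j)[]] := sf k.+1. Qed.

Lemma d_comm f i j : smooth f -> 'd_i ('d_j f) = 'd_j ('d_i f).
Proof.
move=> sf; rewrite /partial; apply: derive_comm; try exact: smooth_derivable.
- exact/smooth_derivable/smooth_d.
- exact/smooth_derivable/smooth_d.
- exact/smooth_continuous/smooth_d/smooth_d.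
- exact/smooth_continuous/smooth_d/smooth_d.
Qed.

Lemma d_cst (c : R) j : 'd_j (fun _ : T => c) = fun=> 0.
Proof. by apply/funext => z; exact: derive_cst. Qed.

Lemma smooth_cst (c : R) : smooth (fun _ : T => c).
Proof.
have cc (c' : R) : continuous (fun _ : T => c') by move=> z; exact: cvg_cst.
move=> k; elim: k c => [|k IH] c; first by split.
by apply: CkS => [|j z|j]; [exact: cc|exact: derivable_cst|rewrite d_cst].
Qed.

Let dDk f g j : (forall z, derivable f z (dir R j)) ->
  (forall z, derivable g z (dir R j)) ->
  'd_j (fun z => f z + g z) = fun z => 'd_j f z + 'd_j g z.
Proof. by move=> df dg; apply/funext => z; exact: deriveD. Qed.

Let dMk f g j : (forall z, derivable f z (dir R j)) ->
  (forall z, derivable g z (dir R j)) ->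
  'd_j (fun z => f z * g z) = fun z => 'd_j f z * g z + f z * 'd_j g z.
Proof.
move=> df dg; apply/funext => z.
apply: etrans (deriveM (df z) (dg z)) _.
by rewrite addrC [X in X + _]mulrC.
Qed.

Lemma dD f g j : smooth f -> smooth g ->
  'd_j (fun z => f z + g z) = fun z => 'd_j f z + 'd_j g z.
Proof. by move=> sf sg; apply: dDk; exact: smooth_derivable. Qed.

Lemma dM f g j : smooth f -> smooth g ->
  'd_j (fun z => f z * g z) = fun z => 'd_j f z * g z + f z * 'd_j g z.
Proof. by move=> sf sg; apply: dMk; exact: smooth_derivable. Qed.

Lemma CkD k f g : Ck k f -> Ck k g -> Ck k (fun z => f z + g z).
Proof.
elim: k f g => [|k IH] f g [cf Hf] [cg Hg].
  by split=> // z; apply: cvgD; [exact: cf|exact: cg].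
apply: CkS => [z|j z|j].
- by apply: cvgD; [exact: cf|exact: cg].
- by have [[df _] [dg _]] := (Hf j, Hg j); exact: derivableD.
- by have [[df sf] [dg sg]] := (Hf j, Hg j); rewrite (dDk df dg); exact: IH.
Qed.

(** The product rule loses no regularity because the undifferentiated factor is
    also of class C^k. *)
Lemma CkM k f g : Ck k f -> Ck k g -> Ck k (fun z => f z * g z).
Proof.
elim: k f g => [|k IH] f g Cf Cg.
  by split=> // z; apply: cvgM; [exact: (Ck_continuous Cf)|exact: (Ck_continuous Cg)].
apply: CkS => [z|j z|j].
- by apply: cvgM; [exact: (Ck_continuous Cf)|exact: (Ck_continuous Cg)].
- by have [[_ /(_ j)[df _]] [_ /(_ j)[dg _]]] := (Cf, Cg); exact: derivableM.
have [[_ /(_ j)[df sf]] [_ /(_ j)[dg sg]]] := (Cf, Cg).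
rewrite (dMk df dg); apply: CkD; apply: IH; [exact: sf|exact: CkW|exact: CkW|exact: sg].
Qed.

Lemma smoothD f g : smooth f -> smooth g -> smooth (fun z => f z + g z).
Proof. by move=> sf sg k; exact: CkD. Qed.

Lemma smoothM f g : smooth f -> smooth g -> smooth (fun z => f z * g z).
Proof. by move=> sf sg k; exact: CkM. Qed.

Lemma smoothZ (c : R) f : smooth f -> smooth (fun z => c * f z).
Proof. by move=> sf; apply: smoothM => //; exact: smooth_cst. Qed.

Lemma dZ (c : R) f j : smooth f -> 'd_j (fun z => c * f z) = fun z => c * 'd_j f z.
Proof.
move=> sf; rewrite dM//; last exact: smooth_cst.
by rewrite d_cst; apply/funext => z; rewrite mul0r add0r.
Qed.

Lemma smoothN f : smooth f -> smooth (fun z => - f z).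
Proof.
move=> sf; have -> : (fun z => - f z) = (fun z => -1 * f z).
  by apply/funext => z; rewrite mulN1r.
exact: smoothZ.
Qed.

Lemma dN f j : smooth f -> 'd_j (fun z => - f z) = fun z => - 'd_j f z.
Proof.
move=> sf; have -> : (fun z => - f z) = (fun z => -1 * f z).
  by apply/funext => z; rewrite mulN1r.
by rewrite dZ//; apply/funext => z; rewrite mulN1r.
Qed.

Lemma smoothB f g : smooth f -> smooth g -> smooth (fun z => f z - g z).
Proof. by move=> sf sg; apply: smoothD => //; exact: smoothN. Qed.

Lemma dB f g j : smooth f -> smooth g ->
  'd_j (fun z => f z - g z) = fun z => 'd_j f z - 'd_j g z.
Proof. by move=> sf sg; rewrite dD//; [rewrite dN|exact: smoothN]. Qed.

Lemma smoothX f n : smooth f -> smooth (fun z => f z ^+ n).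
Proof.
move=> sf; elim: n => [|n IH]; first exact: smooth_cst.
by under eq_fun do rewrite exprS; exact: smoothM.
Qed.

Lemma dX2 f j : smooth f -> 'd_j (fun z => f z ^+ 2) = fun z => 2 * f z * 'd_j f z.
Proof.
move=> sf; under eq_fun do rewrite expr2.
by rewrite dM//; apply/funext => z; ring.
Qed.

Lemma smooth_sum (I : Type) (s : seq I) (F : I -> T -> R) :
  (forall a, smooth (F a)) -> smooth (fun z => \sum_(a <- s) F a z).
Proof.
move=> sF; elim: s => [|a s IH].
  by under eq_fun do rewrite big_nil; exact: smooth_cst.
by under eq_fun do rewrite big_cons; exact: smoothD.
Qed.

Lemma d_sum (I : Type) (s : seq I) (F : I -> T -> R) j :
  (forall a, smooth (F a)) ->
  'd_j (fun z => \sum_(a <- s) F a z) = fun z => \sum_(a <- s) 'd_j (F a) z.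
Proof.
move=> sF; elim: s => [|a s IH].
  under eq_fun do rewrite big_nil.
  by rewrite d_cst; apply/funext => z; rewrite big_nil.
under eq_fun do rewrite big_cons.
rewrite dD//; last exact: smooth_sum.
by rewrite IH; apply/funext => z; rewrite big_cons.
Qed.

Lemma dV f j : (forall z, f z != 0) -> smooth f ->
  'd_j (fun z => (f z)^-1) = fun z => - ('d_j f z * ((f z)^-1 * (f z)^-1)).
Proof.
move=> f0 sf; apply/funext => z; rewrite {1}/partial deriveV//; last exact: smooth_derivable.
rewrite scaleNr -invfM -expr2; congr (- _); exact: mulrC.
Qed.

(** The derivative of 1/f is a polynomial in 1/f and a derivative of f, whence an
    induction on the order of differentiability. *)
Lemma smoothV f : (forall z, f z != 0) -> smooth f -> smooth (fun z => (f z)^-1).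
Proof.
move=> f0 sf.
have cV : continuous (fun z => (f z)^-1).
  by move=> z; apply: cvgV => //; exact: (smooth_continuous sf).
elim=> [|k IH]; first by split.
apply: CkS => [//|j z|j].
  by apply: derivableV => //; exact: smooth_derivable.
rewrite dV//; have -> : (fun z => - ('d_j f z * ((f z)^-1 * (f z)^-1))) =
   (fun z => -1 * ('d_j f z * ((f z)^-1 * (f z)^-1))).
  by apply/funext => z; rewrite mulN1r.
apply: CkM; first exact: smooth_cst.
by apply: CkM; [exact: smooth_d|exact: CkM].
Qed.

Let is_derive_ln f z j : (forall z, 0 < f z) -> smooth f ->
  is_derive z (dir R j) (fun z => ln (f z)) ('d_j f z / f z).
Proof.
move=> f0 sf; rewrite -[X in is_derive X](add0r z) -(scale0r (dir R j)).
apply/is_derive_line.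
have H1 := derivable_line z (smooth_derivable sf (j := j)) 0.
rewrite scale0r add0r in H1.
have H2 : is_derive (f (0 *: dir R j + z)) 1 (@ln R) (f z)^-1.
  by rewrite scale0r add0r; exact: is_derive1_ln.
by have := @is_derive1_comp _ (@ln R) (fun h => f (h *: dir R j + z)) 0 _ _ H2 H1;
  rewrite mulrC.
Qed.

Lemma d_ln f j : (forall z, 0 < f z) -> smooth f ->
  'd_j (fun z => ln (f z)) = fun z => 'd_j f z * (f z)^-1.
Proof.
by move=> f0 sf; apply/funext => z; have [_] := is_derive_ln z j f0 sf.
Qed.

Lemma smooth_ln f : (forall z, 0 < f z) -> smooth f -> smooth (fun z => ln (f z)).
Proof.
move=> f0 sf; have cl : continuous (fun z => ln (f z)).
  move=> z; apply: continuous_comp; first exact: (smooth_continuous sf).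
  exact: continuous_ln.
case=> [|k]; first by split.
apply: CkS => [//|j z|j].
  by have [] := is_derive_ln z j f0 sf.
rewrite d_ln//; apply: smoothM; first exact: smooth_d.
by apply: smoothV => // z; rewrite gt_eqF.
Qed.

Let is_derive_x (l : 'I_N) z j :
  is_derive z (dir R j) (fun z : T => z.1 l 0) (j == Some l)%:R.
Proof.
have E : {near 0^', (fun h : R => (j == Some l)%:R) =1 (fun h : R =>
    h^-1 *: (((fun z : T => z.1 l 0) \o shift z) (h *: dir R j) - z.1 l 0))}.
  rewrite near_withinE; apply: nearW => h h0 /=; rewrite mxE addrK.
  case: j => [i|]/=; rewrite !mxE ?mulr0 ?scaler0//.
  rewrite eqxx andbT (inj_eq (@Some_inj _)) eq_sym.
  by rewrite [_ *: _]mulrA mulVf// mul1r.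
have C : (fun h : R => h^-1 *: (((fun z : T => z.1 l 0) \o shift z) (h *: dir R j)
    - z.1 l 0)) @ 0^' --> ((j == Some l)%:R : R).
  exact: cvg_trans (near_eq_cvg E) (cvg_cst _).
split; last by apply: (cvg_lim _ C).
by apply/cvg_ex; exists (j == Some l)%:R.
Qed.

Lemma d_x (l : 'I_N) j :
  'd_j (fun z : T => z.1 l 0) = fun=> (j == Some l)%:R.
Proof. by apply/funext => z; have [_] := is_derive_x l z j. Qed.

Lemma smooth_x (l : 'I_N) : smooth (fun z : T => z.1 l 0).
Proof.
have cx : continuous (fun z : T => z.1 l 0).
  move=> z; apply: (@continuous_comp _ _ _ fst (fun x : 'cV[R]_N => x l 0)).
    exact: cvg_fst.
  exact: coord_continuous.
case=> [|k]; first by split.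
apply: CkS => [//|j z|j]; last by rewrite d_x; exact: smooth_cst.
by have [] := is_derive_x l z j.
Qed.

Lemma is_derive_time (a a' : R -> R) z j : (forall t : R, is_derive t 1 a (a' t)) ->
  is_derive z (dir R j) (fun z : T => a z.2) (if j is None then a' z.2 else 0).
Proof.
move=> da; rewrite -[X in is_derive X](add0r z) -(scale0r (dir R j)).
apply/is_derive_line; case: j => [i|] /=.
  have -> : (fun h : R => a (h *: (0 : R) + z.2)) = cst (a z.2).
    by apply/funext => h; rewrite scaler0 add0r.
  exact: is_derive_cst.
have H : is_derive (0 : R) 1 (fun h : R => h *: (1 : R) + z.2) 1.
  have -> : (fun h : R => h *: (1 : R) + z.2) = shift z.2.
    by apply/funext => h; rewrite [_%:A]mulr1.
  exact: is_derive_shift.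
have H2 : is_derive ((0 : R) *: (1 : R) + z.2) 1 a (a' z.2).
  by rewrite scale0r add0r; exact: da.
have := @is_derive1_comp _ a (fun h : R => h *: (1 : R) + z.2) 0 _ _ H2 H.
by rewrite [_ \o _]/comp [X in is_derive _ _ _ X]mulr1.
Qed.

Lemma d_time (a a' : R -> R) j : (forall t : R, is_derive t 1 a (a' t)) ->
  'd_j (fun z : T => a z.2) = fun z => if j is None then a' z.2 else 0.
Proof.
by move=> da; apply/funext => z; have [_] := is_derive_time z j da.
Qed.

(** A family of functions of time whose derivatives are linear combinations of
    members of the family can be differentiated for ever; the entries of the flow
    form such a family, by the equation E' = - B E. *)
Lemma smooth_time (I : Type) (a : I -> R -> R) :
  (forall p, exists s : seq (R * I),
     forall t : R, is_derive t 1 (a p) (\sum_(c <- s) c.1 * a c.2 t)) ->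
  forall p, smooth (fun z : T => a p z.2).
Proof.
move=> H p k; elim: k p => [|k IH] p; have [s Hs] := H p.
  split=> // z; apply: (@continuous_comp _ _ _ snd (a p)); first exact: cvg_snd.
  by have [/derivable1_diffP/differentiable_continuous] := Hs z.2.
apply: CkS => [z|j z|j].
- apply: (@continuous_comp _ _ _ snd (a p)); first exact: cvg_snd.
  by have [/derivable1_diffP/differentiable_continuous] := Hs z.2.
- by have [] := is_derive_time z j Hs.
rewrite (d_time j Hs); case: j => [i|]; first exact: smooth_cst.
elim: s {Hs} => [|c s IHs].
  by under eq_fun do rewrite big_nil; exact: smooth_cst.
under eq_fun do rewrite big_cons; apply: CkD => //.
by apply: CkM; [exact: smooth_cst|exact: IH].
Qed.

End smooth_algebra.

(** * The matrix exponential *)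

Section matrix_exponential.
Context {R : realType} {N : nat}.
Implicit Types (A B : 'M[R]_N) (i j : 'I_N) (t : R).

(** Each entry of exp(t A) is a scalar power series in t, with these coefficients. *)
Let cf A i j (k : nat) : R := (k`!%:R)^-1 * (A ^+ k) i j.

Let mxpow_bound A : exists s : R, forall k i j, `|(A ^+ k) i j| <= s ^+ k.
Proof.
pose s := \sum_i \sum_j `|A i j|.
have rows i : \sum_j `|A i j| <= s.
  rewrite /s [leRHS](bigD1 i)//= lerDl sumr_ge0// => l _; exact: sumr_ge0.
exists s; elim=> [|k IH] i j.
  by rewrite !expr0 mxE; case: eqP => _; rewrite ?normr1 ?normr0.
have s0 : 0 <= s by apply: sumr_ge0 => l _; exact: sumr_ge0.
rewrite !exprS mxE; apply: le_trans (ler_norm_sum _ _ _) _.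
apply: (@le_trans _ _ (\sum_l `|A i l| * s ^+ k)).
  by apply: ler_sum => l _; rewrite normrM ler_wpM2l.
by rewrite -mulr_suml ler_wpM2r// exprn_ge0.
Qed.

Let cvg_cf A i j x : cvgn (pseries (cf A i j) x).
Proof.
have [s Hs] := mxpow_bound A.
apply: normed_cvg.
have sx n : `|cf A i j n * x ^+ n| <= exp_coeff (s * `|x|) n.
  rewrite /exp_coeff/= /cf !normrM normfV normr_nat normrX exprMn.
  by rewrite -mulrA mulrC ler_wpM2r ?invr_ge0// ler_wpM2r ?exprn_ge0.
apply: (@series_le_cvg _ _ (exp_coeff (s * `|x|))) => [n|n|n|].
- exact: normr_ge0.
- exact: le_trans (sx n).
- exact: sx.
exact: is_cvg_series_exp_coeff.
Qed.

Lemma expmx_entry A t i j : expmx (t *: A) i j = limn (pseries (cf A i j) t).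
Proof.
have powZ k : (t *: A) ^+ k = t ^+ k *: A ^+ k.
  elim: k => [|k IH]; first by rewrite !expr0 scale1r.
  rewrite !exprS IH -[LHS]/((t *: A) *m (t ^+ k *: A ^+ k)).
  by rewrite -scalemxAl -scalemxAr scalerA.
pose M := \matrix_(i, j) limn (pseries (cf A i j) t).
suff H : series (fun k : nat => (k`!%:R : R)^-1 *: (t *: A) ^+ k) @ \oo --> M.
  by rewrite /expmx (cvg_lim _ H)// mxE.
apply/cvgrPdist_le => /= e e0.
have near i' j' : \forall n \near \oo, `|limn (pseries (cf A i' j') t)
    - pseries (cf A i' j') t n| <= e.
  by have /cvgrPdist_le := @cvg_cf A i' j' t; exact.
near=> n.
rewrite [leLHS]/Num.Def.normr/= mx_normrE (bigmax_le _ (ltW e0))//= => -[i' j'] _ /=.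
rewrite !mxE.
have -> : series (fun k : nat => (k`!%:R : R)^-1 *: (t *: A) ^+ k) n i' j' =
   pseries (cf A i' j') t n.
  rewrite /series/= summxE /pseries/= /series/=; apply: eq_bigr => k _.
  by rewrite powZ !mxE /cf -mulrA [t ^+ k * _]mulrC.
move: i' j'; near: n.
apply: filter_forall => i'; apply: filter_forall => j'; exact: near.
Unshelve. all: by end_near. Qed.

Let cvg_comb (I : finType) (a : I -> R) (c : I -> nat -> R) x :
  (forall l, cvgn (pseries (c l) x)) ->
  pseries (fun k => \sum_l a l * c l k) x @ \oo -->
    \sum_l a l * limn (pseries (c l) x).
Proof.
move=> Hc.
have -> : pseries (fun k => \sum_l a l * c l k) x =
   (fun n => \sum_l a l * pseries (c l) x n).
  apply/funext => n; rewrite /pseries/= /series/=.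
  under [RHS]eq_bigr do rewrite mulr_sumr.
  rewrite exchange_big/=; apply: eq_bigr => k _.
  by rewrite mulr_suml; apply: eq_bigr => l _; rewrite mulrA.
elim: (index_enum I) => [|l s IH].
  by rewrite big_nil; under eq_cvg do rewrite big_nil; exact: cvg_cst.
rewrite big_cons; under eq_cvg do rewrite big_cons.
by apply: cvgD => //; apply: cvgM; [exact: cvg_cst|exact: Hc].
Qed.

Let lim_comb (I : finType) (a : I -> R) (c : I -> nat -> R) x :
  (forall l, cvgn (pseries (c l) x)) ->
  limn (pseries (fun k => \sum_l a l * c l k) x) =
    \sum_l a l * limn (pseries (c l) x).
Proof. by move=> Hc; apply: (cvg_lim _ (cvg_comb Hc)). Qed.

Let diffs_l A i j : pseries_diffs (cf A i j) = fun k => \sum_l A i l * cf A l j k.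
Proof.
apply/funext => k; rewrite /pseries_diffs /cf exprS mxE mulrA.
have -> : k.+1%:R * (k.+1`!%:R)^-1 = (k`!%:R)^-1 :> R.
  by rewrite factS natrM invfM mulVKf.
by rewrite mulr_sumr; apply: eq_bigr => l _; rewrite mulrCA.
Qed.

Let diffs_r A i j : pseries_diffs (cf A i j) = fun k => \sum_l A l j * cf A i l k.
Proof.
apply/funext => k; rewrite /pseries_diffs /cf exprSr mxE mulrA.
have -> : k.+1%:R * (k.+1`!%:R)^-1 = (k`!%:R)^-1 :> R.
  by rewrite factS natrM invfM mulVKf.
by rewrite mulr_sumr; apply: eq_bigr => l _; rewrite mulrA mulrC.
Qed.

(** The formal derivative of the exponential series can be written with A on either
    side, since A commutes with its powers. *)
Lemma expmx_comm A t : A *m expmx (t *: A) = expmx (t *: A) *m A.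
Proof.
apply/matrixP => i j; rewrite !mxE.
transitivity (limn (pseries (pseries_diffs (cf A i j)) t)).
  rewrite diffs_l lim_comb//; apply: eq_bigr => l _; by rewrite expmx_entry.
by rewrite diffs_r lim_comb//; apply: eq_bigr => l _; rewrite expmx_entry mulrC.
Qed.

Lemma is_derive_expmx A i j t :
  is_derive t (1 : R) (fun t => expmx (t *: A) i j) ((A *m expmx (t *: A)) i j).
Proof.
have -> : (fun t => expmx (t *: A) i j) = (fun t => limn (pseries (cf A i j) t)).
  by apply/funext => t'; rewrite expmx_entry.
have -> : (A *m expmx (t *: A)) i j = limn (pseries (pseries_diffs (cf A i j)) t).
  by rewrite diffs_l lim_comb// mxE; apply: eq_bigr => l _; rewrite expmx_entry.
have d2 : pseries_diffs (pseries_diffs (cf A i j)) =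
    fun k => \sum_l A i l * pseries_diffs (cf A l j) k.
  rewrite (diffs_l A i j); apply/funext => k; rewrite {1}/pseries_diffs mulr_sumr.
  by apply: eq_bigr => l _; rewrite mulrCA.
apply: (@pseries_snd_diffs _ _ (`|t| + 1)) => //.
- by rewrite diffs_l; apply/cvg_ex; eexists; exact: cvg_comb.
- rewrite d2; apply/cvg_ex; eexists; apply: cvg_comb => l; rewrite diffs_l.
  by apply/cvg_ex; eexists; exact: cvg_comb.
- by rewrite [ltRHS]ger0_norm ?ltrDl ?ltr01// addr_ge0.
Qed.

Lemma expmx0 A : expmx (0 *: A) = 1%:M.
Proof.
apply/matrixP => i j; rewrite expmx_entry.
apply: cvg_lim => //.
have E : {near \oo, (fun n : nat => (1%:M : 'M[R]_N) i j) =1 pseries (cf A i j) 0}.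
  exists 1 => // -[//|n] _ /=.
  rewrite /pseries/= /series/= big_nat_recl//= big1 => [|k _].
    by rewrite /cf fact0 invr1 mul1r !expr0 mulr1 addr0.
  by rewrite exprS mul0r mulr0.
exact: cvg_trans (near_eq_cvg E) (cvg_cst _).
Qed.

Lemma E_expmx B t : E B t = expmx (t *: - B).
Proof. by rewrite /E scalerN scaleNr. Qed.

Lemma is_derive_E B i j t :
  is_derive t (1 : R) (fun t => E B t i j) (- (B *m E B t) i j).
Proof.
have -> : (fun t => E B t i j) = (fun t => expmx (t *: - B) i j).
  by apply/funext => r; rewrite E_expmx.
have -> : - (B *m E B t) i j = (- B *m E B t) i j by rewrite mulNmx [RHS]mxE.
by rewrite E_expmx; exact: is_derive_expmx.
Qed.

Lemma E_comm B t : B *m E B t = E B t *m B.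
Proof.
by apply: oppr_inj; rewrite -mulNmx -mulmxN E_expmx expmx_comm.
Qed.

Lemma E0 B : E B 0 = 1%:M.
Proof. by rewrite E_expmx expmx0. Qed.

Lemma is_derive_E_shift B i j t1 t :
  is_derive t (1 : R) (fun t => E B (t - t1) i j) (- (B *m E B (t - t1)) i j).
Proof.
have H := is_derive_shift t 1 (- t1).
have := @is_derive1_comp _ (fun t => E B t i j) (shift (- t1)) t _ _
   (is_derive_E B i j (t - t1)) H.
by rewrite mulr1.
Qed.

Lemma is_derive_E_refl B i j t1 t :
  is_derive t (1 : R) (fun t => E B (t1 - t) i j) ((E B (t1 - t) *m B) i j).
Proof.
have H : is_derive t (1 : R) (fun t => t1 - t) (-1).
  have := is_deriveB (is_derive_cst t1 t (1 : R)) (is_derive_id t (1 : R)).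
  by rewrite sub0r.
have := @is_derive1_comp _ (fun t => E B t i j) (fun t => t1 - t) t _ _
   (is_derive_E B i j (t1 - t)) H.
by rewrite mulrN1 opprK E_comm.
Qed.

(** E(t) E(-t) has derivative zero and equals 1 at t = 0. *)
Lemma E_inv B t : E B t *m E B (- t) = 1%:M.
Proof.
suff H i j : (E B t *m E B (- t)) i j = (1%:M : 'M[R]_N) i j by apply/matrixP.
pose F t := (E B t *m E B (0 - t)) i j.
have dF s : is_derive s (1 : R) F 0.
  have -> : F = fun s => \sum_l (E B s i l * E B (0 - s) l j).
    by apply/funext => r; rewrite /F mxE.
  have H (l : 'I_N) := is_deriveM (is_derive_E B i l s) (is_derive_E_refl B l j 0 s).
  have := is_derive_sum H.
  rewrite fct_sumE => /= K; apply: is_derive_eq K _.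
  rewrite big_split/=.
  have -> : \sum_(l < N) E B s i l *: (E B (0 - s) *m B) l j =
     (E B s *m E B (0 - s) *m B) i j by rewrite -mulmxA [RHS]mxE.
  have -> : \sum_(l < N) E B (0 - s) l j *: - (B *m E B s) i l =
     - (B *m E B s *m E B (0 - s)) i j.
    rewrite [in RHS]mxE -sumrN; apply: eq_bigr => l _.
    by rewrite [LHS]mulrC mulNr.
  have -> : B *m E B s *m E B (0 - s) = E B s *m E B (0 - s) *m B.
    by rewrite E_comm -!mulmxA E_comm.
  exact: subrr.
have := is_derive_0_is_cst t 0 dF.
by rewrite /F !sub0r oppr0 E0 mulmx1.
Qed.

End matrix_exponential.

(** * The Frobenius norm of the flow *)

Section frobenius.
Context {R : realType}.

(** The difference of the two sides is half the sum of the squares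
    (a_i b_j - a_j b_i)^2, by Lagrange's identity. *)
Lemma cauchy_schwarz_sum (I : finType) (a b : I -> R) :
  (\sum_i a i * b i) ^+ 2 <= (\sum_i a i ^+ 2) * (\sum_i b i ^+ 2).
Proof.
have H : 0 <= \sum_i \sum_j (a i * b j - a j * b i) ^+ 2.
  by apply: sumr_ge0 => i _; apply: sumr_ge0 => j _; exact: sqr_ge0.
have e : \sum_i \sum_j (a i * b j - a j * b i) ^+ 2 =
    2 * ((\sum_i a i ^+ 2) * (\sum_i b i ^+ 2)) - 2 * (\sum_i a i * b i) ^+ 2.
  have e1 : (\sum_i a i ^+ 2) * (\sum_i b i ^+ 2) =
      \sum_i \sum_j a i ^+ 2 * b j ^+ 2.
    by rewrite mulr_suml; apply: eq_bigr => i _; rewrite mulr_sumr.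
  have e2 : (\sum_i a i ^+ 2) * (\sum_i b i ^+ 2) =
      \sum_i \sum_j a j ^+ 2 * b i ^+ 2.
    by rewrite e1 exchange_big.
  have e3 : (\sum_i a i * b i) ^+ 2 = \sum_i \sum_j (a i * b i) * (a j * b j).
    by rewrite expr2 mulr_suml; apply: eq_bigr => i _; rewrite mulr_sumr.
  rewrite mulr_natl mulr2n {1}e1 e2 e3 mulr_sumr -big_split -sumrB/=.
  apply: eq_bigr => i _; rewrite mulr_sumr -big_split -sumrB/=.
  by apply: eq_bigr => j _; ring.
by move: H; rewrite e -mulrBr pmulr_rge0// subr_ge0.
Qed.

Lemma mulmx_sqr_le (N : nat) (A : 'M[R]_N) (x : 'cV[R]_N) (m : R) :
  \sum_i \sum_j A i j ^+ 2 <= m ->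
  \sum_i (A *m x) i 0 ^+ 2 <= m * \sum_i x i 0 ^+ 2.
Proof.
move=> Am; apply: (@le_trans _ _ ((\sum_i \sum_j A i j ^+ 2) * \sum_i x i 0 ^+ 2)).
  rewrite mulr_suml; apply: ler_sum => i _; rewrite mxE; exact: cauchy_schwarz_sum.
by rewrite ler_wpM2r// sumr_ge0// => i _; exact: sqr_ge0.
Qed.

(** The only use of the hypothesis on the flow.  Each column of E(t) is the image of
    a unit vector; and since t ranges over all real numbers, the bound also holds
    for the inverse matrices E(-t). *)
Lemma E_frobenius (N : nat) (B : 'M[R]_N) :
  (ereal_sup [set (opnorm (E B t))%:E | t in [set: R]] < +oo)%E ->
  exists2 m : R, 1 <= m & forall t, \sum_i \sum_j E B t i j ^+ 2 <= m.
Proof.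
set S := ereal_sup _ => Soo.
have Sub t : ((opnorm (E B t))%:E <= S)%E by apply: ereal_sup_ubound; exists t.
have Sfin : S \is a fin_num.
  rewrite fin_numE; apply/andP; split; last by rewrite lt_eqF.
  by apply: contraTN (Sub 0) => /eqP ->; rewrite -ltNge ltNyr.
pose s := fine S.
have sub t : opnorm (E B t) <= s by rewrite -lee_fin fineK.
have col (A : 'M[R]_N) j : \sum_i A i j ^+ 2 <= opnorm A ^+ 2 /\ 0 <= opnorm A.
  have colE : \sum_i A i j ^+ 2 = enorm (A *m delta_mx j 0) ^+ 2.
    rewrite /enorm sqr_sqrtr; last first.
      by apply: sumr_ge0 => i _; rewrite -expr2 sqr_ge0.
    apply: eq_bigr => i _; rewrite mxE (bigD1 j)//= big1 => [|l lj].
      by rewrite !mxE !eqxx mulr1 addr0 expr2.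
    by rewrite !mxE (negbTE lj) mulr0.
  have ub (x : 'cV[R]_N) : enorm x <= 1 -> enorm (A *m x) <= opnorm A.
    move=> x1; apply: ub_le_sup; last by exists x.
    exists (Num.sqrt (\sum_i \sum_j A i j ^+ 2)) => _ [y y1 <-].
    have dotpE (v : 'cV[R]_N) : dotp v v = \sum_i v i 0 ^+ 2.
      by apply: eq_bigr => i _; rewrite expr2.
    rewrite /enorm; apply: ler_wsqrtr; rewrite dotpE.
    apply: le_trans (mulmx_sqr_le y (lexx _)) _.
    rewrite -[leRHS]mulr1 -dotpE; apply: ler_wpM2l.
      by apply: sumr_ge0 => i _; apply: sumr_ge0 => l _; exact: sqr_ge0.
    have d0 : 0 <= dotp y y by rewrite dotpE; apply: sumr_ge0 => i _; exact: sqr_ge0.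
    by rewrite -(sqr_sqrtr d0) -(expr1n _ 2) ler_pXn2r ?nnegrE ?sqrtr_ge0.
  have dot0 : enorm (0 : 'cV[R]_N) = 0.
    by rewrite /enorm /dotp big1 ?sqrtr0// => i _; rewrite mxE mul0r.
  have o0 : 0 <= opnorm A.
    by apply: le_trans (ub 0 _); [exact: sqrtr_ge0 | rewrite dot0].
  split=> //; rewrite colE ler_pXn2r ?nnegrE ?sqrtr_ge0//.
  apply: ub; rewrite /enorm /dotp (bigD1 j)//= big1 => [|l lj].
    by rewrite mxE !eqxx mulr1 addr0 sqrtr1.
  by rewrite mxE (negbTE lj) mul0r.
exists (1 + \sum_(j < N) s ^+ 2) => [|t].
  by rewrite lerDl sumr_ge0// => j _; exact: sqr_ge0.
rewrite exchange_big/=; apply: (@le_trans _ _ (\sum_(j < N) s ^+ 2)); last first.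
  by rewrite lerDr.
apply: ler_sum => j _; have [c1 o0] := col (E B t) j; apply: le_trans c1 _.
by rewrite ler_pXn2r ?nnegrE// (le_trans o0).
Qed.

End frobenius.

(** * The moving frame and the linearised logarithmic equation *)

Opaque partial.

#[global] Hint Resolve smooth_d smoothD smoothM smoothN smoothB smooth_cst smoothX
  smooth_sum smooth_x smoothZ : smooth.

Section moving_frame.
Context {R : realType} {N : nat} (B : 'M[R]_N) (t1 : R).
Local Notation T := ('cV[R]_N * R)%type.
Implicit Types (f g h : T -> R) (z : T) (i k l : 'I_N).

Definition drift l z : R := \sum_k B l k * z.1 k 0.
(** The time derivative in the coordinates carried by the flow: the equation of the
    theorem reads transport u = Lap u. *)
Definition transport g z : R := 'd_None g z - \sum_l drift l z * 'd_(Some l) g z.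
(** Component l of the vector E(t - t1) e_k, constant in the coordinates carried by
    the flow. *)
Definition frame l k z : R := E B (z.2 - t1) l k.
Definition frame_d k g z : R := \sum_l frame l k z * 'd_(Some l) g z.

Lemma smooth_drift l : smooth (drift l).
Proof. by rewrite /drift; auto with smooth. Qed.

Lemma d_drift l j : 'd_j (drift l) = fun=> if j is Some i then B l i else 0.
Proof.
rewrite /drift d_sum; last by auto with smooth.
apply/funext => z; rewrite (eq_bigr (fun k => B l k * (j == Some k)%:R)); last first.
  by move=> k _; rewrite dZ; [rewrite d_x | exact: smooth_x].
case: j => [i|]; last by rewrite big1// => k _; rewrite mulr0.
rewrite (bigD1 i)//= eqxx mulr1 big1 ?addr0// => k ki.
by rewrite (inj_eq (@Some_inj _)) eq_sym (negbTE ki) mulr0.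
Qed.

Lemma smooth_frame l k : smooth (frame l k).
Proof.
apply: (@smooth_time _ _ 'I_N (fun p t => E B (t - t1) p k)) => p.
exists [seq (- B p q, q) | q <- enum 'I_N] => t.
have := is_derive_E_shift B p k t1 t.
by rewrite mxE -sumrN big_map big_enum/=; under eq_bigr do rewrite -mulNr.
Qed.

Lemma d_frame l k j : 'd_j (frame l k) =
  fun z => if j is None then - \sum_p B l p * frame p k z else 0.
Proof.
rewrite (d_time j (fun t => is_derive_E_shift B l k t1 t)).
by apply/funext => z; case: j => //; rewrite mxE.
Qed.

Hint Resolve smooth_drift smooth_frame : smooth.

Lemma smooth_transport g : smooth g -> smooth (transport g).
Proof. by move=> sg; rewrite /transport; auto 7 with smooth. Qed.

Lemma smooth_frame_d k g : smooth g -> smooth (frame_d k g).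
Proof. by move=> sg; rewrite /frame_d; auto 7 with smooth. Qed.

Hint Resolve smooth_transport smooth_frame_d : smooth.

Lemma d_frame_d k g i : smooth g -> 'd_(Some i) (frame_d k g) = frame_d k ('d_(Some i) g).
Proof.
move=> sg; rewrite /frame_d d_sum; last by auto with smooth.
apply/funext => z; apply: eq_bigr => l _.
rewrite dM; auto with smooth.
by rewrite d_frame/= mul0r add0r d_comm.
Qed.

(** The bracket of the two operators has two terms: one from the time derivative
    - B xi of the frame vectors xi, one from the derivative B xi of the drift along
    them, and they cancel. *)
Lemma frame_d_transport k g : smooth g -> frame_d k (transport g) = transport (frame_d k g).
Proof.
move=> sg; apply/funext => z.
have lhs : frame_d k (transport g) z = \sum_l frame l k z * 'd_None ('d_(Some l) g) z
   - \sum_l \sum_p frame l k z * (B p l * 'd_(Some p) g z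
   + drift p z * 'd_(Some l) ('d_(Some p) g) z).
  rewrite /frame_d -sumrB; apply: eq_bigr => l _; rewrite /transport dB; auto 7 with smooth.
  rewrite (d_comm None (Some l) sg) d_sum; auto with smooth.
  rewrite mulrBr; congr (_ - _); rewrite mulr_sumr; apply: eq_bigr => p _.
  by rewrite dM; auto with smooth; rewrite d_drift.
have rhs : transport (frame_d k g) z =
   \sum_l (frame l k z * 'd_None ('d_(Some l) g) z) -
   (\sum_l \sum_p B l p * frame p k z * 'd_(Some l) g z) -
   \sum_p \sum_l frame l k z * (drift p z * 'd_(Some l) ('d_(Some p) g) z).
  rewrite /transport; congr (_ - _).
    rewrite /frame_d d_sum; last by auto with smooth.
    rewrite -sumrB; apply: eq_bigr => l _; rewrite dM; auto with smooth.
    by rewrite d_frame/= mulNr addrC mulr_suml.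
  apply: eq_bigr => p _; rewrite d_frame_d// /frame_d mulr_sumr; apply: eq_bigr => l _.
  by rewrite mulrCA.
rewrite lhs rhs -addrA -opprD; congr (_ - _).
rewrite [X in X + _]exchange_big [X in _ + X]exchange_big -big_split/=.
apply: eq_bigr => l _; rewrite -big_split/=; apply: eq_bigr => p _.
by rewrite mulrDr; congr (_ + _); rewrite mulrCA mulrA.
Qed.

Lemma frame_dD k g h : smooth g -> smooth h ->
  frame_d k (fun z => g z + h z) = fun z => frame_d k g z + frame_d k h z.
Proof.
move=> sg sh; apply/funext => z; rewrite /frame_d -big_split/=.
by apply: eq_bigr => l _; rewrite dD// mulrDr.
Qed.

Lemma frame_dM k g h : smooth g -> smooth h ->
  frame_d k (fun z => g z * h z) = fun z => frame_d k g z * h z + g z * frame_d k h z.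
Proof.
move=> sg sh; apply/funext => z; rewrite /frame_d mulr_suml mulr_sumr -big_split/=.
by apply: eq_bigr => l _; rewrite dM//; ring.
Qed.

Lemma frame_dZ c k g : smooth g -> frame_d k (fun z => c * g z) = fun z => c * frame_d k g z.
Proof.
move=> sg; apply/funext => z; rewrite /frame_d mulr_sumr; apply: eq_bigr => l _.
by rewrite dZ// mulrCA.
Qed.

Lemma frame_d_sum k (I : Type) (s : seq I) (F : I -> T -> R) : (forall a, smooth (F a)) ->
  frame_d k (fun z => \sum_(a <- s) F a z) = fun z => \sum_(a <- s) frame_d k (F a) z.
Proof.
move=> sF; apply/funext => z; rewrite /frame_d exchange_big/=.
by apply: eq_bigr => l _; rewrite d_sum// mulr_sumr.
Qed.

Lemma transportD g h : smooth g -> smooth h ->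
  transport (fun z => g z + h z) = fun z => transport g z + transport h z.
Proof.
move=> sg sh; apply/funext => z; rewrite /transport dD// addrACA -opprD; congr (_ - _).
by rewrite -big_split/=; apply: eq_bigr => l _; rewrite dD// mulrDr.
Qed.

Lemma transportM g h : smooth g -> smooth h ->
  transport (fun z => g z * h z) = fun z => transport g z * h z + g z * transport h z.
Proof.
move=> sg sh; apply/funext => z; rewrite /transport dM// mulrBl mulrBr addrACA -opprD.
congr (_ - _); rewrite mulr_suml mulr_sumr -big_split/=.
by apply: eq_bigr => l _; rewrite dM//; ring.
Qed.

Context (f : T -> R).
Hypothesis sf : smooth f.
Hypothesis eqf : forall z, transport f z =
  \sum_i ('d_(Some i) ('d_(Some i) f) z + 'd_(Some i) f z ^+ 2).

(** The linearisation at f of the equation transport f = Lap f + |grad f|^2. *)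
Definition log_op g z : R :=
  \sum_i ('d_(Some i) ('d_(Some i) g) z + 2 * 'd_(Some i) f z * 'd_(Some i) g z) - transport g z.

Lemma log_opD g h z : smooth g -> smooth h -> log_op (fun z => g z + h z) z = log_op g z + log_op h z.
Proof.
move=> sg sh; rewrite /log_op transportD// [RHS]addrACA -opprD; congr (_ - _).
rewrite -big_split/=; apply: eq_bigr => i _.
have [sdg sdh] := (smooth_d (Some i) sg, smooth_d (Some i) sh).
rewrite (dD _ sg sh) (dD _ sdg sdh).
move: ('d_ _ _ z) ('d_ _ _ z) ('d_ _ g z) ('d_ _ h z) ('d_ _ f z) => a b c d e.
ring.
Qed.

(** The only second-order part of log_op is the Laplacian, so the defect of the
    product rule is twice the inner product of the gradients. *)
Lemma log_opM g h z : smooth g -> smooth h ->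
  log_op (fun z => g z * h z) z = g z * log_op h z + log_op g z * h z +
    2 * \sum_i 'd_(Some i) g z * 'd_(Some i) h z.
Proof.
move=> sg sh; rewrite /log_op (transportM sg sh).
set SG := \sum_i _; set Sh := \sum_i ('d_(Some i) ('d_(Some i) h) z + _).
set Sg := \sum_i ('d_(Some i) ('d_(Some i) g) z + _).
set S := \sum_i 'd_(Some i) g z * _.
have -> : SG = g z * Sh + Sg * h z + 2 * S.
  rewrite /SG /Sh /Sg /S !mulr_sumr mulr_suml -!big_split/=; apply: eq_bigr => i _.
  have [sdg sdh] := (smooth_d (Some i) sg, smooth_d (Some i) sh).
  rewrite (dM _ sg sh) (dD _ (smoothM sdg sh) (smoothM sg sdh)).
  rewrite (dM _ sdg sh) (dM _ sg sdh).
  move: ('d_(Some i) ('d_(Some i) g) z) ('d_(Some i) ('d_(Some i) h) z).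
  move: ('d_(Some i) g z) ('d_(Some i) h z) ('d_(Some i) f z) (g z) (h z) => *.
  ring.
move: SG Sh Sg S (transport g z) (transport h z) (g z) (h z) => *.
ring.
Qed.

Lemma log_opZ c g z : smooth g -> log_op (fun z => c * g z) z = c * log_op g z.
Proof.
move=> sg; rewrite (log_opM _ (smooth_cst c) sg).
rewrite (_ : log_op (fun=> c) z = 0) ?mul0r ?addr0; last first.
  rewrite /log_op /transport d_cst !big1 ?subr0// => l _; first by rewrite d_cst mulr0.
  by rewrite !d_cst mulr0 addr0.
by rewrite big1 ?mulr0 ?addr0// => l _; rewrite d_cst mul0r.
Qed.

Lemma log_op_sum (I : Type) (s : seq I) (F : I -> T -> R) z : (forall a, smooth (F a)) ->
  log_op (fun z => \sum_(a <- s) F a z) z = \sum_(a <- s) log_op (F a) z.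
Proof.
move=> sF; elim: s => [|a s IH].
  under eq_fun do rewrite big_nil.
  rewrite big_nil /log_op /transport d_cst !big1 ?subr0// => i _; first by rewrite d_cst mulr0.
  by rewrite !d_cst mulr0 addr0.
under eq_fun do rewrite big_cons.
by rewrite log_opD//; [rewrite IH big_cons | auto with smooth].
Qed.

(** Apply the frame derivative to the equation of f and commute it inside. *)
Lemma transport_frame_d k : transport (frame_d k f) = fun z =>
  \sum_i ('d_(Some i) ('d_(Some i) (frame_d k f)) z + 2 * 'd_(Some i) f z * 'd_(Some i) (frame_d k f) z).
Proof.
rewrite -frame_d_transport// (_ : transport f = fun z => \sum_i ('d_(Some i) ('d_(Some i) f) z +
    'd_(Some i) f z * 'd_(Some i) f z)); last first.
  by apply/funext => z; rewrite eqf; under eq_bigr do rewrite expr2.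
rewrite frame_d_sum; last by auto 7 with smooth.
apply/funext => z; apply: eq_bigr => i _.
have s1 := smooth_d (Some i) sf; have s2 := smooth_d (Some i) s1.
rewrite (frame_dD k s2 (smoothM s1 s1)) (frame_dM k s1 s1) (d_frame_d k i sf) (d_frame_d k i s1).
move: (frame_d k ('d_(Some i) ('d_(Some i) f)) z) => a.
move: (frame_d k ('d_(Some i) f) z) ('d_(Some i) f z) => b c.
ring.
Qed.

Lemma log_op_frame_d k z : log_op (frame_d k f) z = 0.
Proof. by rewrite /log_op transport_frame_d subrr. Qed.

(** Differentiating once more, the quadratic term of the equation leaves the square
    of the mixed derivative. *)
Lemma log_op_frame_d2 k z : log_op (frame_d k (frame_d k f)) z = - (2 * \sum_i ('d_(Some i) (frame_d k f) z) ^+ 2).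
Proof.
rewrite /log_op -frame_d_transport; last by auto with smooth.
rewrite transport_frame_d frame_d_sum; last by auto 9 with smooth.
rewrite -sumrB mulr_sumr -sumrN; apply: eq_bigr => i _.
have s1 := smooth_d (Some i) sf; have s2 := smooth_frame_d k sf.
have s3 := smooth_d (Some i) s2; have s4 := smooth_d (Some i) s3.
rewrite (frame_dD k s4 (smoothM (smoothZ 2 s1) s3)) (frame_dM k (smoothZ 2 s1) s3) (frame_dZ 2 k s1).
rewrite -(d_frame_d k i s2) -(d_frame_d k i s3) -(d_frame_d k i s2) -(d_frame_d k i sf).
move: ('d_(Some i) ('d_(Some i) (frame_d k (frame_d k f))) z) => a.
move: ('d_(Some i) (frame_d k (frame_d k f)) z) => b.
move: ('d_(Some i) (frame_d k f) z) => c.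
move: ('d_(Some i) f z) => d.
ring.
Qed.

(** The factor 1/2 may be any number strictly between 0 and 1: the squares then keep
    a negative sign in log_op_liyau, and the gradient keeps a positive one here. *)
Definition liyau z : R := \sum_k (frame_d k (frame_d k f) z + 2^-1 * (frame_d k f z * frame_d k f z)).

Lemma smooth_liyau : smooth liyau.
Proof. by rewrite /liyau; auto 9 with smooth. Qed.

(** The term - 2 |grad D_k f|^2 of the second derivative is half compensated by the
    product rule for (D_k f)^2, whose own factor is annihilated by log_op. *)
Lemma log_op_liyau z : log_op liyau z = - \sum_k \sum_i ('d_(Some i) (frame_d k f) z) ^+ 2.
Proof.
rewrite /liyau log_op_sum; last by auto 9 with smooth.
rewrite -sumrN; apply: eq_bigr => k _.
have s1 := smooth_frame_d k sf; have s2 := smooth_frame_d k s1.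
rewrite (log_opD _ s2 (smoothZ 2^-1 (smoothM s1 s1))) log_op_frame_d2 (log_opZ _ _ (smoothM s1 s1)).
rewrite (log_opM _ s1 s1) log_op_frame_d.
have -> : \sum_i 'd_(Some i) (frame_d k f) z * 'd_(Some i) (frame_d k f) z =
   \sum_i 'd_(Some i) (frame_d k f) z ^+ 2 by apply: eq_bigr => i _; rewrite expr2.
move: (\sum_i 'd_(Some i) (frame_d k f) z ^+ 2) (frame_d k f z) => a b.
lra.
Qed.

End moving_frame.

(** * Derivatives at a minimum along a line *)

Section local_minimum.
Context {R : realType} {N : nat}.
Local Notation T := ('cV[R]_N * R)%type.
Implicit Types (g : T -> R) (z : T) (j : option 'I_N).

Lemma mvt_d g j z (h : R) : smooth g -> 0 < h ->
  (exists2 c : R, 0 < c < h & g (h *: dir R j + z) - g z = h * 'd_j g (c *: dir R j + z)) /\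
  (exists2 c : R, 0 < c < h & g z - g (- h *: dir R j + z) = h * 'd_j g (- c *: dir R j + z)).
Proof.
move=> sg h0; have dl := derivable_line z (smooth_derivable sg (j := j)).
have cont (a b : R) : {within `[a, b], continuous (fun h : R => g (h *: dir R j + z))}.
  by apply: derivable_within_continuous => t _; have [] := dl t.
split.
  have [c] := MVT h0 (fun t _ => dl t) (cont _ _).
  rewrite in_itv/= scale0r add0r subr0 => cI ->.
  by exists c; rewrite // mulrC.
have h0' : - h < 0 by rewrite oppr_lt0.
have [c] := MVT h0' (fun t _ => dl t) (cont _ _).
rewrite in_itv/= scale0r add0r sub0r opprK => /andP[c1 c2] ->.
by exists (- c); rewrite ?opprK; [rewrite oppr_gt0 c2 ltrNl | rewrite mulrC].
Qed.

Lemma lt_near_line g j z (c : R) : smooth g -> g z < c ->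
  exists2 e : R, 0 < e & forall h, `|h| < e -> g (h *: dir R j + z) < c.
Proof.
move=> sg gc.
have cg : {for (0 : R), continuous (fun h : R => g (h *: dir R j + z))}.
  apply: differentiable_continuous; apply/derivable1_diffP.
  by have [] := derivable_line z (smooth_derivable sg (j := j)) 0.
have gc0 : 0 < c - g z by rewrite subr_gt0.
move/cvgrPdist_lt : cg => /(_ _ gc0) /nbhs_ballP[e /= e0 H].
exists e => // h he.
have : `|g ((0 : R) *: dir R j + z) - g (h *: dir R j + z)| < c - g z.
  by apply: H; rewrite -ball_normE/= sub0r normrN.
rewrite scale0r add0r; move: (g z) (g _) => a b /ltr_normlP[]; lra.
Qed.

Lemma d_gt0_near g j z : smooth g -> 0 < 'd_j g z ->
  exists2 e : R, 0 < e & forall h, `|h| < e -> 0 < 'd_j g (h *: dir R j + z).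
Proof.
move=> sg; rewrite -oppr_lt0 => /(lt_near_line j (smoothN (smooth_d j sg)))[e e0 H].
by exists e => // h /H; rewrite oppr_lt0.
Qed.

(** One-sided, since the minimum may be attained at the final time of the
    cylinder. *)
Lemma min_left_d_le0 g j z (e : R) : smooth g -> 0 < e ->
  (forall h, 0 < h < e -> g z <= g (- h *: dir R j + z)) -> 'd_j g z <= 0.
Proof.
move=> sg e0 H; rewrite leNgt; apply/negP => d0.
have [e' e'0 H'] := d_gt0_near sg d0.
pose h := Num.min e e' / 2.
have m0 : 0 < Num.min e e' by rewrite lt_min e0.
have h0 : 0 < h by rewrite divr_gt0.
have hm : h < Num.min e e' by rewrite ltr_pdivrMr// ltr_pMr// ltr1n.
have he : h < e by rewrite (lt_le_trans hm)// ge_min lexx.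
have he' : h < e' by rewrite (lt_le_trans hm)// ge_min lexx orbT.
have [_ [c /andP[c0 ch] E]] := mvt_d j z sg h0.
have := H h; rewrite h0 he => /(_ isT); rewrite -subr_le0 E leNgt => /negP; apply.
by rewrite mulr_gt0// H'// normrN gtr0_norm// (lt_trans ch).
Qed.

Lemma min_right_d_ge0 g j z (e : R) : smooth g -> 0 < e ->
  (forall h, 0 < h < e -> g z <= g (h *: dir R j + z)) -> 0 <= 'd_j g z.
Proof.
move=> sg e0 H; rewrite leNgt; apply/negP => d0.
have sg' := smoothN sg.
have d0' : 0 < 'd_j (fun z => - g z) z by rewrite dN// oppr_gt0.
have [e' e'0 H'] := d_gt0_near sg' d0'.
pose h := Num.min e e' / 2.
have m0 : 0 < Num.min e e' by rewrite lt_min e0.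
have h0 : 0 < h by rewrite divr_gt0.
have hm : h < Num.min e e' by rewrite ltr_pdivrMr// ltr_pMr// ltr1n.
have he : h < e by rewrite (lt_le_trans hm)// ge_min lexx.
have he' : h < e' by rewrite (lt_le_trans hm)// ge_min lexx orbT.
have [[c /andP[c0 ch] E] _] := mvt_d j z sg' h0.
have := H h; rewrite h0 he => /(_ isT); rewrite leNgt => /negP; apply.
have : 0 < - g (h *: dir R j + z) - - g z.
  by rewrite E mulr_gt0// H'// gtr0_norm// (lt_trans ch).
by rewrite opprK addrC subr_gt0.
Qed.

Lemma min_d2_ge0 g j z (e : R) : smooth g -> 0 < e ->
  (forall h, 0 < h < e -> g z <= g (h *: dir R j + z)) -> 'd_j g z = 0 ->
  0 <= 'd_j ('d_j g) z.
Proof.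
move=> sg e0 H d0; rewrite leNgt; apply/negP => dd0.
have sg' := smoothN (smooth_d j sg).
have dd0' : 0 < 'd_j (fun z => - 'd_j g z) z.
  by rewrite (dN _ (smooth_d j sg)) oppr_gt0.
have [e' e'0 H'] := d_gt0_near sg' dd0'.
pose h := Num.min e e' / 2.
have m0 : 0 < Num.min e e' by rewrite lt_min e0.
have h0 : 0 < h by rewrite divr_gt0.
have hm : h < Num.min e e' by rewrite ltr_pdivrMr// ltr_pMr// ltr1n.
have he : h < e by rewrite (lt_le_trans hm)// ge_min lexx.
have he' : h < e' by rewrite (lt_le_trans hm)// ge_min lexx orbT.
have [[c /andP[c0 ch] E1] _] := mvt_d j z sg h0.
have [[c' /andP[c'0 ch'] E2] _] := mvt_d j z sg' c0.
have := H h; rewrite h0 he => /(_ isT); rewrite -subr_ge0 E1 pmulr_rge0// leNgt.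
move/negP; apply; rewrite -oppr_gt0.
have := H' c'; rewrite (gtr0_norm c'0) (lt_trans ch' (lt_trans ch he')) => /(_ isT) p.
by move: (mulr_gt0 c0 p); rewrite -E2 d0 oppr0 subr0.
Qed.

End local_minimum.

(** * The cut-off function *)

Section cutoff.
Context {R : realType} {N : nat} (B : 'M[R]_N) (m : R) (t1 : R) (x1 : 'cV[R]_N) (r : R).
Hypothesis Em : forall t, \sum_i \sum_j E B t i j ^+ 2 <= m.
Local Notation T := ('cV[R]_N * R)%type.
Implicit Types (g h : T -> R) (z : T) (i k l : 'I_N).

(** The inverse of the matrix frame. *)
Definition coframe k l z : R := E B (t1 - z.2) k l.
(** Coordinates carried by the flow, centred at x1 and agreeing with those of space
    at the time t1. *)
Definition frame_coord k z : R := \sum_l coframe k l z * z.1 l 0 - x1 k 0.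
Definition sqdist z : R := \sum_k frame_coord k z ^+ 2.
Definition elapsed z : R := z.2 - t1 + r ^+ 2.
Definition gap z : R := r ^+ 2 - sqdist z.
(** Vanishes on the lateral and on the initial boundary of the cylinder, but not at
    the final time.  The square makes |grad cutoff|^2 / cutoff bounded. *)
Definition cutoff z : R := gap z ^+ 2 * elapsed z.

Lemma smooth_t : smooth (fun z : T => z.2).
Proof.
apply: (@smooth_time _ _ bool (fun b t => if b then t else 1)) true => b.
case: b; last by exists [::] => t; rewrite big_nil; exact: is_derive_cst.
exists [:: (1, false)] => t; rewrite big_seq1 mulr1; exact: is_derive_id.
Qed.

Lemma d_t j : 'd_j (fun z : T => z.2) = fun=> if j is None then 1 else 0.
Proof. exact: (d_time j (fun t : R => is_derive_id t (1 : R))). Qed.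

Lemma smooth_coframe k l : smooth (coframe k l).
Proof.
apply: (@smooth_time _ _ 'I_N (fun p t => E B (t1 - t) k p)) => p.
exists [seq (B q p, q) | q <- enum 'I_N] => t.
have := is_derive_E_refl B k p t1 t.
by rewrite mxE big_map big_enum/=; under eq_bigr do rewrite mulrC.
Qed.

Lemma d_coframe k l j : 'd_j (coframe k l) =
  fun z => if j is None then \sum_p coframe k p z * B p l else 0.
Proof.
rewrite (d_time j (fun t => is_derive_E_refl B k l t1 t)).
by apply/funext => z; case: j => //; rewrite mxE.
Qed.

Hint Resolve smooth_t smooth_coframe : smooth.

Lemma smooth_frame_coord k : smooth (frame_coord k).
Proof. by rewrite /frame_coord; auto 7 with smooth. Qed.

Lemma d_frame_coord_x k i : 'd_(Some i) (frame_coord k) = coframe k i.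
Proof.
rewrite /frame_coord dB; auto 7 with smooth; rewrite d_cst d_sum; auto with smooth.
apply/funext => z; rewrite subr0 (bigD1 i)//= big1 => [|l li].
  by rewrite (dM _ (smooth_coframe _ _) (smooth_x _)) d_coframe d_x eqxx mul0r add0r mulr1 addr0.
rewrite (dM _ (smooth_coframe _ _) (smooth_x _)) d_coframe d_x mul0r add0r.
by rewrite (inj_eq (@Some_inj _)) eq_sym (negbTE li) mulr0.
Qed.

Lemma d_frame_coord_t k z : 'd_None (frame_coord k) z =
  \sum_l (\sum_p coframe k p z * B p l) * z.1 l 0.
Proof.
rewrite /frame_coord dB; auto 7 with smooth; rewrite d_cst d_sum; auto with smooth.
rewrite subr0; apply: eq_bigr => l _.
by rewrite (dM _ (smooth_coframe _ _) (smooth_x _)) d_coframe d_x mulr0 addr0.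
Qed.

(** The inverse frame has time derivative (coframe) B, which compensates the drift. *)
Lemma transport_frame_coord k z : transport B (frame_coord k) z = 0.
Proof.
rewrite /transport d_frame_coord_t; apply/eqP; rewrite subr_eq0; apply/eqP.
under eq_bigr do rewrite mulr_suml.
rewrite exchange_big/=; apply: eq_bigr => p _; rewrite d_frame_coord_x /drift mulr_suml.
by apply: eq_bigr => l _; rewrite -mulrA mulrC.
Qed.

Hint Resolve smooth_frame_coord : smooth.

Lemma smooth_sqdist : smooth sqdist.
Proof. by rewrite /sqdist; auto with smooth. Qed.

Lemma d_sqdist j : 'd_j sqdist = fun z => \sum_k 2 * frame_coord k z * 'd_j (frame_coord k) z.
Proof.
rewrite /sqdist d_sum; last by auto with smooth.
by apply/funext => z; apply: eq_bigr => k _; rewrite (dX2 _ (smooth_frame_coord k)).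
Qed.

Lemma d2_sqdist i z : 'd_(Some i) ('d_(Some i) sqdist) z = 2 * \sum_k coframe k i z ^+ 2.
Proof.
rewrite d_sqdist d_sum; last by auto 7 with smooth.
rewrite mulr_sumr; apply: eq_bigr => k _; rewrite d_frame_coord_x.
rewrite (dM _ (smoothZ 2 (smooth_frame_coord k)) (smooth_coframe k i)) d_coframe mulr0 addr0.
by rewrite (dZ _ _ (smooth_frame_coord k)) d_frame_coord_x expr2 mulrA.
Qed.

Lemma transport_sqdist z : transport B sqdist z = 0.
Proof.
rewrite /transport d_sqdist.
under [X in _ - X]eq_bigr do rewrite d_sqdist mulr_sumr.
rewrite exchange_big/= -sumrB big1// => k _.
have := transport_frame_coord k z; rewrite /transport => /eqP; rewrite subr_eq0 => /eqP ->.
rewrite mulr_sumr; apply/eqP; rewrite subr_eq0; apply/eqP.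
by apply: eq_bigr => l _; rewrite mulrCA.
Qed.

Lemma coframe_tr z (v : 'I_N -> R) :
  \sum_i (\sum_k coframe k i z * v k) ^+ 2 <= m * \sum_k v k ^+ 2.
Proof.
have := @mulmx_sqr_le _ _ (E B (t1 - z.2))^T (\col_k v k) m.
under [X in X <= m -> _]eq_bigr do under eq_bigr do rewrite mxE.
rewrite exchange_big/= => /(_ (Em _)).
under [X in X <= _ -> _]eq_bigr do rewrite mxE.
under [X in X <= _ -> _]eq_bigr do under eq_bigr do rewrite !mxE.
by under [X in _ <= _ * X -> _]eq_bigr do rewrite mxE.
Qed.

Lemma grad_sqdist z : \sum_i 'd_(Some i) sqdist z ^+ 2 <= 4 * m * sqdist z.
Proof.
rewrite (eq_bigr (fun i => 4 * (\sum_k coframe k i z * frame_coord k z) ^+ 2)).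
  rewrite -mulr_sumr -mulrA ler_wpM2l//; exact: coframe_tr.
move=> i _; rewrite d_sqdist.
under eq_bigr do rewrite d_frame_coord_x -mulrA.
rewrite -mulr_sumr exprMn; congr (_ * _ ^+ 2); first by ring.
by apply: eq_bigr => k _; rewrite mulrC.
Qed.

Lemma lap_sqdist z : 0 <= \sum_i 'd_(Some i) ('d_(Some i) sqdist) z <= 2 * m.
Proof.
under eq_bigr do rewrite d2_sqdist.
rewrite -mulr_sumr; apply/andP; split.
  by rewrite mulr_ge0// sumr_ge0// => i _; rewrite sumr_ge0// => k _; exact: sqr_ge0.
by rewrite ler_wpM2l// exchange_big; exact: Em.
Qed.

Lemma smooth_elapsed : smooth elapsed.
Proof. by rewrite /elapsed; auto with smooth. Qed.

Lemma d_elapsed j : 'd_j elapsed = fun=> if j is None then 1 else 0.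
Proof.
rewrite /elapsed (dD _ (smoothB smooth_t (smooth_cst _)) (smooth_cst _)).
by rewrite (dB _ smooth_t (smooth_cst _)) !d_cst d_t; apply/funext => z; rewrite subr0 addr0.
Qed.

Lemma smooth_gap : smooth gap.
Proof. by rewrite /gap; apply: smoothB; [exact: smooth_cst|exact: smooth_sqdist]. Qed.

Lemma d_gap j : 'd_j gap = fun z => - 'd_j sqdist z.
Proof.
rewrite /gap (dB _ (smooth_cst _) smooth_sqdist) d_cst.
by apply/funext => z; rewrite sub0r.
Qed.

Lemma smooth_cutoff : smooth cutoff.
Proof. by rewrite /cutoff; apply: smoothM; [apply: smoothX; exact: smooth_gap|exact: smooth_elapsed]. Qed.

Lemma d_cutoff j : 'd_j cutoff = fun z => - 2 * gap z * elapsed z * 'd_j sqdist z +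
  gap z ^+ 2 * (if j is None then 1 else 0).
Proof.
rewrite /cutoff (dM _ (smoothX 2 smooth_gap) smooth_elapsed) (dX2 _ smooth_gap) d_gap d_elapsed.
by apply/funext => z; case: j => [j|]; ring.
Qed.

Lemma d2_cutoff i z : 'd_(Some i) ('d_(Some i) cutoff) z =
  2 * elapsed z * 'd_(Some i) sqdist z ^+ 2 - 2 * gap z * elapsed z * 'd_(Some i) ('d_(Some i) sqdist) z.
Proof.
rewrite (_ : 'd_(Some i) cutoff = fun z => (-2 * gap z) * (elapsed z * 'd_(Some i) sqdist z)); last first.
  by rewrite d_cutoff; apply/funext => y; ring.
have s1 := smooth_d (Some i) smooth_sqdist.
rewrite (dM _ (smoothZ _ smooth_gap) (smoothM smooth_elapsed s1)).
rewrite (dZ _ _ smooth_gap) (dM _ smooth_elapsed s1) d_gap d_elapsed.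
move: ('d_(Some i) ('d_(Some i) sqdist) z) ('d_(Some i) sqdist z) => a b; ring.
Qed.

Lemma transport_cutoff z : transport B cutoff z = gap z ^+ 2.
Proof.
have := transport_sqdist z; rewrite /transport => /eqP; rewrite subr_eq0 => /eqP E.
rewrite (eq_bigr (fun l => -2 * gap z * elapsed z * (drift B l z * 'd_(Some l) sqdist z))); last first.
  by move=> l _; rewrite d_cutoff; move: ('d_(Some l) sqdist z) => a; ring.
by rewrite -mulr_sumr d_cutoff E mulr1 addrC addKr.
Qed.

End cutoff.

(** * The estimate at an interior minimum *)

(** The elementary inequality behind the estimate.  Here g is minus the value of
    liyau at the minimum, p the squared frame gradient of f, K the sum of the
    squares of the derivatives d_i D_k f, S = <grad f, grad sqdist>,
    a = |grad sqdist|^2 and q = Lap sqdist.  Only S is unbounded; after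
    multiplication by d^2 tau it is absorbed by the p^2 contained in K. *)
Lemma cutoff_inequality (R : realFieldType) (m Q d tau g p K S a q : R) :
  1 <= m -> 0 < d <= Q -> 0 < tau <= Q -> 0 < g -> 0 <= p ->
  (g + 2^-1 * p) ^+ 2 <= m * K -> S ^+ 2 <= 4 * m ^+ 2 * Q * p ->
  0 <= a <= 4 * m * Q -> 0 <= q <= 2 * m ->
  d ^+ 2 * tau * K <= g * (6 * tau * a + 2 * d * tau * q + 4 * d * tau * S + d ^+ 2) ->
  d ^+ 2 * tau * g <= 82 * m ^+ 4 * Q ^+ 2.
Proof.
move=> m1 /andP[d0 dQ] /andP[t0 tQ] g0 p0 HK HS /andP[a0 aQ] /andP[q0 qm] H.
have m0 : 0 < m by apply: lt_le_trans m1.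
have Q0 : 0 < Q by apply: lt_le_trans dQ.
pose psi := d ^+ 2 * tau.
have psi0 : 0 < psi by rewrite mulr_gt0 ?exprn_gt0.
pose M := psi * g; pose Y := psi * p; pose W := d * tau * S.
have M0 : 0 < M by rewrite mulr_gt0.
have Y0 : 0 <= Y by rewrite mulr_ge0// ltW.
have s1 : M ^+ 2 + Y ^+ 2 / 4 <= psi ^+ 2 * (m * K).
  apply: le_trans (ler_wpM2l (sqr_ge0 psi) HK).
  have -> : psi ^+ 2 * (g + 2^-1 * p) ^+ 2 = M ^+ 2 + Y ^+ 2 / 4 + M * Y.
    by rewrite /M /Y; field.
  by rewrite lerDl mulr_ge0// ltW.
have s2 : psi ^+ 2 * (m * K) <=
    m * M * (6 * tau * a + 2 * d * tau * q + 4 * W + d ^+ 2).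
  have -> : psi ^+ 2 * (m * K) = psi * m * (d ^+ 2 * tau * K).
    by rewrite /psi; ring.
  have -> : m * M * (6 * tau * a + 2 * d * tau * q + 4 * W + d ^+ 2) =
     psi * m * (g * (6 * tau * a + 2 * d * tau * q + 4 * d * tau * S + d ^+ 2)).
    by rewrite /M /W; ring.
  by rewrite ler_wpM2l// mulr_ge0// ltW.
have dQ2 : d ^+ 2 <= Q ^+ 2 by rewrite ler_pXn2r// nnegrE ltW.
have ta : tau * a <= 4 * m * Q ^+ 2.
  have -> : 4 * m * Q ^+ 2 = Q * (4 * m * Q) by ring.
  by rewrite ler_pM// ltW.
have dtq : d * tau * q <= 2 * m * Q ^+ 2.
  have -> : 2 * m * Q ^+ 2 = (Q * Q) * (2 * m) by ring.
  by rewrite ler_pM// ?mulr_ge0 ?ler_pM// ltW.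
have s4 : W ^+ 2 <= 4 * m ^+ 2 * Q ^+ 2 * Y.
  have -> : W ^+ 2 = (d ^+ 2 * tau ^+ 2) * S ^+ 2 by rewrite /W; ring.
  apply: le_trans (ler_wpM2l _ HS) _; first by rewrite mulr_ge0// sqr_ge0.
  have -> : d ^+ 2 * tau ^+ 2 * (4 * m ^+ 2 * Q * p) = (4 * m ^+ 2 * Q * Y) * tau.
    by rewrite /Y /psi; ring.
  have -> : 4 * m ^+ 2 * Q ^+ 2 * Y = (4 * m ^+ 2 * Q * Y) * Q by ring.
  by rewrite ler_wpM2l// !mulr_ge0// ?sqr_ge0// ltW.
(* the weight in this arithmetic-geometric mean leaves Y / 2, which s7 and s8 absorb
   into the term Y ^+ 2 / 4 of s1 *)
have s5 : 4 * m * W <= Y / 2 + 32 * m ^+ 4 * Q ^+ 2.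
  have c0 : 0 < 8 * m ^+ 2 * Q ^+ 2 by rewrite !mulr_gt0// exprn_gt0.
  rewrite -(ler_pM2l c0).
  have := sqr_ge0 (W - 16 * m ^+ 3 * Q ^+ 2).
  have -> : (W - 16 * m ^+ 3 * Q ^+ 2) ^+ 2 =
    W ^+ 2 - 8 * m ^+ 2 * Q ^+ 2 * (4 * m * W) + 256 * m ^+ 6 * Q ^+ 4 by ring.
  have -> : 8 * m ^+ 2 * Q ^+ 2 * (Y / 2 + 32 * m ^+ 4 * Q ^+ 2) =
     4 * m ^+ 2 * Q ^+ 2 * Y + 256 * m ^+ 6 * Q ^+ 4 by field.
  move: s4; lra.
have mm n : m * Q ^+ 2 <= m ^+ n.+1 * Q ^+ 2.
  rewrite ler_wpM2r ?sqr_ge0// exprS ler_peMr ?exprn_ege1// ltW//.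
have s6 : m * (6 * tau * a + 2 * d * tau * q + 4 * W + d ^+ 2) <=
   Y / 2 + 61 * m ^+ 4 * Q ^+ 2.
  have e2 : m * (tau * a) <= 4 * m ^+ 4 * Q ^+ 2.
    apply: le_trans (ler_wpM2l (ltW m0) ta) _.
    have -> : m * (4 * m * Q ^+ 2) = 4 * (m ^+ 2 * Q ^+ 2) by ring.
    rewrite -mulrA ler_pM2l// ler_wpM2r ?sqr_ge0//.
    by rewrite -[leLHS]mulr1 (_ : 4 = 2 + 2)%N// exprD ler_wpM2l ?sqr_ge0// exprn_ege1.
  have e3 : m * (d * tau * q) <= 2 * m ^+ 4 * Q ^+ 2.
    apply: le_trans (ler_wpM2l (ltW m0) dtq) _.
    have -> : m * (2 * m * Q ^+ 2) = 2 * (m ^+ 2 * Q ^+ 2) by ring.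
    rewrite -mulrA ler_pM2l// ler_wpM2r ?sqr_ge0//.
    by rewrite -[leLHS]mulr1 (_ : 4 = 2 + 2)%N// exprD ler_wpM2l ?sqr_ge0// exprn_ege1.
  have e4 : m * d ^+ 2 <= m ^+ 4 * Q ^+ 2.
    by apply: le_trans (mm 3); rewrite ler_wpM2l// ltW.
  move: e2 e3 e4 s5.
  have -> : m * (6 * tau * a + 2 * d * tau * q + 4 * W + d ^+ 2) =
    6 * (m * (tau * a)) + 2 * (m * (d * tau * q)) + 4 * m * W + m * d ^+ 2 by ring.
  lra.
have s7 : M ^+ 2 + Y ^+ 2 / 4 <= M * (Y / 2) + M * (61 * m ^+ 4 * Q ^+ 2).
  rewrite -mulrDr; apply: le_trans s1 _; apply: le_trans s2 _.
  by rewrite (mulrC m M) -(mulrA M m) ler_pM2l.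
have s8 : M * (3 / 4 * M) <= M * (61 * m ^+ 4 * Q ^+ 2).
  have -> : M * (3 / 4 * M) = 3 / 4 * M ^+ 2 by ring.
  have : M * (Y / 2) <= M ^+ 2 / 4 + Y ^+ 2 / 4.
    have := sqr_ge0 (M - Y).
    have -> : (M - Y) ^+ 2 = M ^+ 2 - 4 * (M * (Y / 2)) + Y ^+ 2 by field.
    lra.
  move: s7; lra.
rewrite ler_pM2l// in s8.
have X0 : 0 <= m ^+ 4 * Q ^+ 2 by rewrite mulr_ge0 ?sqr_ge0// exprn_ge0// ltW.
have s9 : 3 / 4 * M <= 61 * (m ^+ 4 * Q ^+ 2) by rewrite mulrA.
have -> : 82 * m ^+ 4 * Q ^+ 2 = 82 * (m ^+ 4 * Q ^+ 2) by rewrite mulrA.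
rewrite -/psi -/M; lra.
Qed.

Section interior_estimate.
Context {R : realType} {N : nat} (B : 'M[R]_N) (m : R) (t1 : R) (x1 : 'cV[R]_N) (r : R).
Hypothesis m1 : 1 <= m.
Hypothesis Em : forall t, \sum_i \sum_j E B t i j ^+ 2 <= m.
Local Notation T := ('cV[R]_N * R)%type.
Implicit Types (z : T) (i k l : 'I_N).
Context (f : T -> R).
Hypothesis sf : smooth f.
Hypothesis eqf : forall z, transport B f z =
  \sum_i ('d_(Some i) ('d_(Some i) f) z + 'd_(Some i) f z ^+ 2).

Local Notation frame_d := (frame_d B t1).
Local Notation liyau := (liyau B t1 f).
Local Notation psi := (cutoff B t1 x1 r).
Local Notation rho := (sqdist B t1 x1).
Local Notation tau := (elapsed t1 r).
Local Notation gap := (gap B t1 x1 r).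

(** The gradient is the image of the frame gradient by the transposed inverse frame. *)
Lemma grad_le_frame z :
  \sum_i 'd_(Some i) f z ^+ 2 <= m * \sum_k frame_d k f z ^+ 2.
Proof.
apply: le_trans (coframe_tr t1 Em z (fun k => frame_d k f z)).
rewrite le_eqVlt; apply/orP; left; apply/eqP.
apply: eq_bigr => i _; congr (_ ^+ 2).
under eq_bigr do rewrite mulr_sumr.
rewrite exchange_big/= (bigD1 i)//= [X in _ + X]big1 ?addr0 => [|l li].
  under eq_bigr do rewrite mulrA.
  rewrite -mulr_suml.
  have := E_inv B (z.2 - t1); rewrite opprB => /matrixP/(_ i i); rewrite !mxE eqxx.
  under eq_bigr do rewrite mulrC.
  by move=> /= ->; rewrite mul1r.
under eq_bigr do rewrite mulrA.
rewrite -mulr_suml.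
have := E_inv B (z.2 - t1); rewrite opprB => /matrixP/(_ l i); rewrite !mxE (negbTE li).
under eq_bigr do rewrite mulrC.
by move=> /= ->; rewrite mul0r.
Qed.

(** The frame Laplacian is the Frobenius product of the frame and the matrix of the
    derivatives d_l D_k f. *)
Lemma frame_laplacian_le z :
  (\sum_k frame_d k (frame_d k f) z) ^+ 2 <= m * \sum_k \sum_i 'd_(Some i) (frame_d k f) z ^+ 2.
Proof.
rewrite (_ : \sum_k frame_d k (frame_d k f) z = \sum_(q : 'I_N * 'I_N)
   frame B t1 q.2 q.1 z * 'd_(Some q.2) (frame_d q.1 f) z); last first.
  by rewrite -(pair_bigA _ (fun k l => frame B t1 l k z * 'd_(Some l) (frame_d k f) z)).
apply: le_trans (cauchy_schwarz_sum _ _) _.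
rewrite -(pair_bigA _ (fun k l => frame B t1 l k z ^+ 2))/=.
rewrite -(pair_bigA _ (fun k l => 'd_(Some l) (frame_d k f) z ^+ 2))/=.
apply: ler_wpM2r; first by apply: sumr_ge0 => k _; apply: sumr_ge0 => l _; exact: sqr_ge0.
by rewrite exchange_big; exact: Em.
Qed.

(** At the minimum, log_op (cutoff * liyau) >= 0 because the gradient vanishes, the
    Laplacian is non-negative and the time derivative non-positive.  Expanding by
    the product rule, with cutoff grad liyau = - liyau grad cutoff, leaves an
    inequality between numbers. *)
Lemma liyau_at_min z : 0 < gap z -> 0 < tau z -> z.2 <= t1 -> liyau z < 0 ->
  (forall i, 'd_(Some i) (fun z => psi z * liyau z) z = 0) ->
  (forall i, 0 <= 'd_(Some i) ('d_(Some i) (fun z => psi z * liyau z)) z) ->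
  'd_None (fun z => psi z * liyau z) z <= 0 ->
  - (psi z * liyau z) <= 82 * m ^+ 4 * r ^+ 4.
Proof.
move=> gap0 tau0 zt G0 H1 H2 H3.
have sG := smooth_liyau B t1 sf; have sp := smooth_cutoff B t1 x1 r.
have LpG : 0 <= log_op B f (fun z => psi z * liyau z) z.
  rewrite /log_op /transport; apply: (@le_trans _ _ (\sum_i 'd_(Some i) ('d_(Some i) (fun z => psi z * liyau z)) z)).
    by apply: sumr_ge0 => i _; exact: H2.
  under [X in _ <= X - _]eq_bigr do rewrite H1 mulr0 addr0.
  rewrite lerDl oppr_ge0 subr_le0.
  by rewrite [leRHS]big1// => l _; rewrite H1 mulr0.
rewrite (log_opM B f z sp sG) (log_op_liyau t1 sf eqf) in LpG.
set K := \sum_k \sum_i _ in LpG.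
pose S := \sum_i 'd_(Some i) f z * 'd_(Some i) rho z.
pose a := \sum_i 'd_(Some i) rho z ^+ 2.
pose q := \sum_i 'd_(Some i) ('d_(Some i) rho) z.
have Lpsi : log_op B f psi z = 2 * tau z * a - 2 * gap z * tau z * q
    - 4 * gap z * tau z * S - gap z ^+ 2.
  rewrite /log_op transport_cutoff; congr (_ - _).
  rewrite /a /q /S !mulr_sumr -!sumrB; apply: eq_bigr => i _.
  rewrite d2_cutoff d_cutoff.
  move: ('d_(Some i) ('d_(Some i) rho) z) ('d_(Some i) rho z) ('d_(Some i) f z) => *.
  ring.
have gradpsi i : 'd_(Some i) psi z = - 2 * gap z * tau z * 'd_(Some i) rho z.
  by rewrite d_cutoff mulr0 addr0.
have psi0 : 0 < psi z by rewrite mulr_gt0// exprn_gt0.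
have cross : \sum_i 'd_(Some i) psi z * 'd_(Some i) liyau z = - liyau z * (4 * tau z * a).
  rewrite /a !mulr_sumr; apply: eq_bigr => i _.
  have := H1 i; rewrite (dM _ sp sG) gradpsi /cutoff.
  move: ('d_(Some i) rho z) ('d_(Some i) liyau z) (gap z) (tau z) (liyau z) gap0 tau0.
  move=> c e d t g d0 t0 E.
  (* d ^+ 2 * t is the cut-off function, and E says that the gradient vanishes *)
  have d2t : d ^+ 2 * t != 0 by rewrite mulf_neq0 ?expf_neq0// gt_eqF.
  apply: (mulfI d2t).
  have -> : d ^+ 2 * t * (- 2 * d * t * c * e) = - 2 * d * t * c * (d ^+ 2 * t * e) by ring.
  have -> : d ^+ 2 * t * e = - (- 2 * d * t * c * g).
    by apply/eqP; rewrite -subr_eq0 opprK addrC E.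
  ring.
have rho0 : 0 <= rho z by apply: sumr_ge0 => k _; exact: sqr_ge0.
have rhoQ : rho z <= r ^+ 2 by move: gap0; rewrite /gap subr_gt0 => /ltW.
pose p := \sum_k frame_d k f z ^+ 2.
have p0 : 0 <= p by apply: sumr_ge0 => k _; exact: sqr_ge0.
have r4 : r ^+ 4 = (r ^+ 2) ^+ 2 by rewrite -exprM.
have m0 : 0 < m by apply: lt_le_trans m1.
have a4 : a <= 4 * m * r ^+ 2.
  apply: le_trans (grad_sqdist t1 x1 Em z) _.
  by rewrite ler_wpM2l// mulr_ge0// ltW.
have a0 : 0 <= a by apply: sumr_ge0 => i _; exact: sqr_ge0.
rewrite r4 -mulrN; apply: (@cutoff_inequality _ m (r ^+ 2) (gap z) (tau z) (- liyau z) p K S a q) => //.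
- by rewrite gap0 /gap lerBlDr lerDl.
- by rewrite tau0 /elapsed gerDr subr_le0.
- by rewrite oppr_gt0.
- apply: le_trans (frame_laplacian_le z); rewrite le_eqVlt; apply/orP; left; apply/eqP.
  have -> : \sum_k frame_d k (frame_d k f) z = liyau z - 2^-1 * p.
    apply/eqP; rewrite eq_sym subr_eq; apply/eqP; rewrite /p mulr_sumr -big_split/=.
    by apply: eq_bigr => k _; rewrite expr2.
  ring.
- apply: le_trans (cauchy_schwarz_sum _ _) _.
  rewrite -/a; apply: le_trans (ler_pM _ a0 (grad_le_frame z) a4) _.
    by apply: sumr_ge0 => i _; exact: sqr_ge0.
  by rewrite -/p le_eqVlt; apply/orP; left; apply/eqP; ring.
- by rewrite a0.
- exact: lap_sqdist.
rewrite -/(psi z).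
move: LpG; rewrite Lpsi cross.
have -> : psi z = gap z ^+ 2 * tau z by [].
move: (liyau z) (gap z) (tau z) => g d t.
by rewrite -subr_ge0 => H; rewrite -subr_ge0; apply: le_trans H _; rewrite le_eqVlt; apply/orP; left; apply/eqP; ring.
Qed.

End interior_estimate.

(** * Compactness of the moving cylinder *)

Section cylinder.
Context {R : realType} {N : nat} (B : 'M[R]_N) (t1 : R) (x1 : 'cV[R]_N) (r : R).
Hypothesis r0 : 0 < r.
Local Notation T := ('cV[R]_N * R)%type.
Implicit Types (z : T) (i k l : 'I_N).

Definition cylinder : set T :=
  [set z | sqdist B t1 x1 z <= r ^+ 2] `&` [set z | t1 - r ^+ 2 <= z.2 <= t1].

Let continuous_cV (U : topologicalType) (F : U -> 'cV[R]_N) :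
  (forall i, continuous (fun w => F w i 0)) -> continuous F.
Proof.
move=> cF w; apply/cvgrPdist_le => /= e e0.
have near i : \forall y \near w, `|F w i 0 - F y i 0| <= e.
  by have /cvgrPdist_le := cF i w; exact.
near=> y.
rewrite [leLHS]/Num.Def.normr/= mx_normrE (bigmax_le _ (ltW e0))//= => -[i j] _ /=.
rewrite !mxE ord1; move: i; near: y.
by apply: filter_forall => i; exact: near.
Unshelve. all: by end_near. Qed.

(** The cylinder is a closed part of the image of a box by this map, which leaves the
    coordinates carried by the flow. *)
Let untwist (w : 'rV[R]_N * R) : T := (E B (w.2 - t1) *m w.1^T, w.2).

Let continuous_untwist : continuous untwist.
Proof.
have c1 : continuous (fun w : 'rV[R]_N * R => E B (w.2 - t1) *m w.1^T).
  apply: continuous_cV => i.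
  have -> : (fun w : 'rV[R]_N * R => (E B (w.2 - t1) *m w.1^T) i 0) =
      (fun w => \sum_l E B (w.2 - t1) i l * w.1 0 l).
    by apply/funext => w; rewrite mxE; apply: eq_bigr => l _; rewrite mxE.
  have term l : continuous (fun w : 'rV[R]_N * R => E B (w.2 - t1) i l * w.1 0 l).
    move=> w; apply: cvgM.
      apply: (@continuous_comp _ _ _ snd (fun t => E B (t - t1) i l)); first exact: cvg_snd.
      by have [/derivable1_diffP/differentiable_continuous] := is_derive_E_shift B i l t1 w.2.
    apply: (@continuous_comp _ _ _ fst (fun v : 'rV[R]_N => v 0 l)); first exact: cvg_fst.
    exact: coord_continuous.
  elim: (index_enum _) => [|l s IH].
    by under eq_fun do rewrite big_nil; move=> w; exact: cvg_cst.
  under eq_fun do rewrite big_cons.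
  by move=> w; apply: cvgD; [exact: term | exact: IH].
move=> w; have c2 : (fun w : 'rV[R]_N * R => w.2) @ w --> w.2 by exact: cvg_snd.
exact: (cvg_pair (c1 w) c2).
Qed.

Lemma compact_cylinder : compact cylinder.
Proof.
pose box := [set v : 'rV[R]_N | forall i, `[x1 i 0 - r, x1 i 0 + r]%classic (v 0 i)]
  `*` `[t1 - r ^+ 2, t1]%classic.
have cbox : compact box.
  apply: compact_setX; last exact: segment_compact.
  apply: (@rV_compact _ _ (fun i => `[x1 i 0 - r, x1 i 0 + r]%classic)) => i.
  exact: segment_compact.
apply: (@subclosed_compact _ _ (untwist @` box)).
- apply: closedI.
    apply: (@preimage_closed _ _ (sqdist B t1 x1) [set x | x <= r ^+ 2]).
      by move=> z _; exact: (smooth_continuous (smooth_sqdist B t1 x1)).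
    exact: closed_le.
  rewrite (_ : [set z | _] = [set z : T | t1 - r ^+ 2 <= z.2] `&` [set z | z.2 <= t1]).
    apply: closedI.
      apply: (@preimage_closed _ _ (fun z : T => z.2) [set x | t1 - r ^+ 2 <= x]).
        by move=> z _; exact: cvg_snd.
      exact: closed_ge.
    apply: (@preimage_closed _ _ (fun z : T => z.2) [set x | x <= t1]).
      by move=> z _; exact: cvg_snd.
    exact: closed_le.
  by apply/seteqP; split=> z /=; [move/andP | move=> [-> ->]].
- by apply: continuous_compact => //; exact: continuous_subspaceT.
move=> z [/= zr /andP[zt1 zt2]].
exists ((E B (t1 - z.2) *m z.1)^T, z.2).
  split=> /=; last by rewrite in_itv/= zt1 zt2.
  move=> i; rewrite /= in_itv/= !mxE.
  have H : `|frame_coord B t1 x1 i z| <= r.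
    have : frame_coord B t1 x1 i z ^+ 2 <= r ^+ 2.
      apply: le_trans zr; rewrite /sqdist (bigD1 i)//= lerDl.
      by apply: sumr_ge0 => l _; exact: sqr_ge0.
    by rewrite -(@ler_sqr _ `|_|) ?nnegrE ?(ltW r0)// real_normK// num_real.
  move: H; rewrite /frame_coord /coframe ler_norml; move: (\sum_l _) => s /andP[h1 h2].
  by apply/andP; split; lra.
rewrite /untwist/= trmxK mulmxA -[t1 - z.2]opprB E_inv mul1mx.
by case: z {zr zt1 zt2}.
Qed.

End cylinder.

(** * The Laplacian of the logarithm of a solution *)

Section log_laplacian.
Context {R : realType} {N : nat} (B : 'M[R]_N) (m : R).
Hypothesis m1 : 1 <= m.
Hypothesis Em : forall t, \sum_i \sum_j E B t i j ^+ 2 <= m.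
Local Notation T := ('cV[R]_N * R)%type.
Implicit Types (z : T) (i k l : 'I_N).
Context (f : T -> R).
Hypothesis sf : smooth f.
Hypothesis eqf : forall z, transport B f z =
  \sum_i ('d_(Some i) ('d_(Some i) f) z + 'd_(Some i) f z ^+ 2).

(** If liyau is negative at the centre then cutoff * liyau has a negative minimum on
    the cylinder.  The cut-off function is positive there, so the point lies off the
    lateral and the initial boundary, and liyau_at_min applies. *)
Lemma liyau_lower_bound (x1 : 'cV[R]_N) (t1 r : R) : 0 < r ->
  - liyau B t1 f (x1, t1) * r ^+ 2 <= 82 * m ^+ 4.
Proof.
move=> r0.
set g1 := liyau _ _ _ _.
have [g1_ge0|g1_lt0] := leP 0 g1.
  apply: (@le_trans _ _ 0); first by rewrite mulNr oppr_le0 mulr_ge0// sqr_ge0.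
  by rewrite mulr_ge0// exprn_ge0// (le_trans ler01).
pose z1 : T := (x1, t1).
pose psi := cutoff B t1 x1 r.
pose F z := psi z * liyau B t1 f z.
have sF : smooth F by apply: smoothM; [exact: smooth_cutoff | exact: smooth_liyau].
have rho1 : sqdist B t1 x1 z1 = 0.
  rewrite /sqdist big1// => k _; rewrite /frame_coord /coframe /= subrr E0.
  rewrite (bigD1 k)//= big1 => [|l lk]; first by rewrite mxE eqxx mul1r addr0 subrr expr0n.
  by rewrite mxE eq_sym (negbTE lk) mul0r.
have psi1 : psi z1 = r ^+ 4 * r ^+ 2.
  by rewrite /psi /cutoff /gap rho1 subr0 /elapsed /= subrr add0r -exprM.
have r2 : 0 < r ^+ 2 by rewrite exprn_gt0.
have z1K : cylinder B t1 x1 r z1.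
  by split=> /=; [rewrite rho1 ltW | rewrite lexx andbT gerBl ltW].
have [z0 z0K z0min] : exists2 c, c \in cylinder B t1 x1 r &
    forall t, t \in cylinder B t1 x1 r -> F c <= F t.
  apply: compact_EVT_min; [by exists z1 | exact: compact_cylinder |].
  by apply: continuous_subspaceT; exact: smooth_continuous.
have {}z0min z : cylinder B t1 x1 r z -> F z0 <= F z.
  by move=> zK; apply: z0min; rewrite inE.
move: z0K; rewrite inE => -[/= zr /andP[zt zt1]].
have F1 : F z1 < 0 by rewrite /F psi1 pmulr_rlt0// mulr_gt0// exprn_gt0.
have F0 : F z0 < 0 := le_lt_trans (z0min _ z1K) F1.
have gap0 : 0 <= gap B t1 x1 r z0 by rewrite subr_ge0.
have tau0 : 0 <= elapsed t1 r z0 by rewrite /elapsed; move: zt; lra.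
have psi0 : psi z0 != 0 by apply: contraTneq F0 => e; rewrite /F e mul0r ltxx.
have gap1 : 0 < gap B t1 x1 r z0.
  rewrite lt_neqAle gap0 andbT eq_sym; apply: contraNneq psi0 => e.
  by rewrite /psi /cutoff e expr0n mul0r.
have tau1 : 0 < elapsed t1 r z0.
  rewrite lt_neqAle tau0 andbT eq_sym; apply: contraNneq psi0 => e.
  by rewrite /psi /cutoff e mulr0.
have psi00 : 0 < psi z0 by rewrite /psi /cutoff mulr_gt0// exprn_gt0.
have G0 : liyau B t1 f z0 < 0 by move: F0; rewrite /F pmulr_rlt0.
have rho0 : sqdist B t1 x1 z0 < r ^+ 2 by rewrite -subr_gt0.
have space i : exists2 e : R, 0 < e &
    forall h, `|h| < e -> F z0 <= F (h *: dir R (Some i) + z0).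
  have [e e0 H] := lt_near_line (Some i) (smooth_sqdist B t1 x1) rho0.
  exists e => // h /H he; apply: z0min; split; first exact: ltW.
  by rewrite /= scaler0 add0r zt.
have dF0 i : 'd_(Some i) F z0 = 0.
  have [e e0 H] := space i.
  apply/eqP; rewrite eq_le; apply/andP; split.
    apply: (min_left_d_le0 sF e0) => h /andP[h0 he].
    by apply: H; rewrite normrN gtr0_norm.
  apply: (min_right_d_ge0 sF e0) => h /andP[h0 he].
  by apply: H; rewrite gtr0_norm.
have key : - F z0 <= 82 * m ^+ 4 * r ^+ 4.
  apply: (liyau_at_min m1 Em sf eqf) => //.
  - move=> i; have [e e0 H] := space i.
    apply: (min_d2_ge0 sF e0) => [h /andP[h0 he]|]; last exact: dF0.
    by apply: H; rewrite gtr0_norm.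
  - have [e e0 H] := lt_near_line None (smooth_sqdist B t1 x1) rho0.
    have m0 : 0 < Num.min e (elapsed t1 r z0) by rewrite lt_min e0.
    apply: (min_left_d_le0 sF m0) => h; rewrite lt_min => /and3P[h0 he ht].
    apply: z0min; split; first by rewrite /= ltW// H// normrN gtr0_norm.
    move: ht; rewrite /elapsed /= [(- h)%:A]mulr1 => ht; move: zt1 zt => *.
    by apply/andP; split; lra.
have := le_trans _ key; move/(_ (- F z1)); rewrite lerN2 => /(_ (z0min _ z1K)).
have r4 : 0 < r ^+ 4 by rewrite exprn_gt0.
have -> : - F z1 = r ^+ 4 * (- g1 * r ^+ 2) by rewrite /F psi1 -/g1; ring.
by rewrite [_ * r ^+ 4]mulrC ler_pM2l.
Qed.

(** The bound of liyau_lower_bound at a given point holds for every radius, and the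
    reference time t1 of the frame is taken to be the time of that point. *)
Lemma log_laplacian_ge z :
  0 <= \sum_i ('d_(Some i) ('d_(Some i) f) z + 2^-1 * 'd_(Some i) f z ^+ 2).
Proof.
have frame1 k g : frame_d B z.2 k g z = 'd_(Some k) g z.
  rewrite /frame_d (bigD1 k)//= big1 => [|l lk].
    by rewrite /frame subrr E0 mxE eqxx mul1r addr0.
  by rewrite /frame subrr E0 mxE (negbTE lk) mul0r.
have <- : liyau B z.2 f z =
    \sum_i ('d_(Some i) ('d_(Some i) f) z + 2^-1 * 'd_(Some i) f z ^+ 2).
  rewrite /liyau; apply: eq_bigr => k _.
  by rewrite frame1 d_frame_d// frame1 frame1 expr2.
have H := @liyau_lower_bound z.1 z.2; move: H; rewrite -surjective_pairing.
set g := liyau _ _ _ _ => H.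
rewrite leNgt; apply/negP => g0.
have g0' : 0 < - g by rewrite oppr_gt0.
pose M := 82 * m ^+ 4.
have M0 : 0 < M by rewrite mulr_gt0// exprn_gt0// (lt_le_trans ltr01).
(* this radius satisfies r ^+ 2 >= r > M / - g *)
pose r := M / - g + 1.
have r1 : 1 <= r by rewrite lerDr divr_ge0// ltW.
have := H r (lt_le_trans ltr01 r1); rewrite leNgt => /negP; apply.
apply: (@lt_le_trans _ _ (- g * r)).
  by rewrite -/M /r mulrDr [- g * (M / _)]mulrC divfK ?gt_eqF// mulr1 ltrDl.
by rewrite ler_pM2l// expr2 ler_peMr// (le_trans ler01).
Qed.

End log_laplacian.

(** * The Harnack inequality *)

Section harnack.
Context {R : realType} {N : nat} (B : 'M[R]_N) (m : R).
Hypothesis m1 : 1 <= m.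
Hypothesis Em : forall t, \sum_i \sum_j E B t i j ^+ 2 <= m.
Local Notation T := ('cV[R]_N * R)%type.
Implicit Types (z : T) (i k l : 'I_N).

Lemma opL_transport (u : T -> R) z :
  opL B u z = \sum_i 'd_(Some i) ('d_(Some i) u) z - transport B u z.
Proof.
rewrite /opL /transport opprB addrA; congr (_ + _ - _).
by apply: eq_bigr => i _; rewrite !mxE.
Qed.

Lemma opL_eq_d (u v : T -> R) z : (forall j, 'd_j v = 'd_j u) ->
  opL B v z = opL B u z.
Proof.
move=> e; rewrite !opL_transport /transport.
have e2 i : 'd_(Some i) ('d_(Some i) v) = 'd_(Some i) ('d_(Some i) u).
  exact: (congr1 (partial (Some i)) (e (Some i))).
have S : \sum_i 'd_(Some i) ('d_(Some i) v) z = \sum_i 'd_(Some i) ('d_(Some i) u) z.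
  by apply: eq_bigr => i _; rewrite e2.
have S' : \sum_l drift B l z * 'd_(Some l) v z = \sum_l drift B l z * 'd_(Some l) u z.
  by apply: eq_bigr => l _; rewrite (e (Some l)).
exact: (congr2 (fun a b => a - b) S (congr2 (fun a b => a - b) (congr1 (@^~ z) (e None)) S')).
Qed.

Lemma log_heat (v : T -> R) : smooth v -> (forall z, 0 < v z) ->
  (forall z, opL B v z = 0) -> forall z, transport B (fun z => ln (v z)) z =
  \sum_i ('d_(Some i) ('d_(Some i) (fun z => ln (v z))) z +
          'd_(Some i) (fun z => ln (v z)) z ^+ 2).
Proof.
move=> sv v0 Lv z.
have vn0 y : v y != 0 by rewrite gt_eqF.
have -> : transport B (fun z => ln (v z)) z = transport B v z * (v z)^-1.
  rewrite /transport (d_ln _ v0 sv) mulrBl mulr_suml; congr (_ - _).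
  by apply: eq_bigr => l _; rewrite (d_ln _ v0 sv) mulrA.
have := Lv z; rewrite opL_transport => /eqP; rewrite subr_eq0 => /eqP <-.
rewrite mulr_suml; apply: eq_bigr => i _.
have s1 := smooth_d (Some i) sv.
rewrite (d_ln _ v0 sv) (dM _ s1 (smoothV vn0 sv)) (dV _ vn0 sv).
move: ('d_(Some i) ('d_(Some i) v) z) ('d_(Some i) v z) (v z) (vn0 z) => a b c c0.
by field.
Qed.

(** The drift of the curve c is chosen such that f grows along it at the rate
    transport f + <w, grad f>; completing the square leaves - |w|^2 / 2. *)
Lemma log_harnack (f : T -> R) (x0 y : 'cV[R]_N) (t0 tau : R) : smooth f ->
  (forall z, transport B f z =
    \sum_i ('d_(Some i) ('d_(Some i) f) z + 'd_(Some i) f z ^+ 2)) ->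
  P (y, tau) ->
  f (y + E B tau *m x0, t0 + tau) <= f (x0, t0) + 2 * m ^+ 2.
Proof.
move=> sf eqf; rewrite /P/= => Py.
have m0 : 0 <= m by rewrite (le_trans ler01).
have y2 : enorm y ^+ 2 = \sum_i y i 0 ^+ 2.
  rewrite /enorm sqr_sqrtr; first by apply: eq_bigr => i _; rewrite expr2.
  by apply: sumr_ge0 => i _; rewrite -expr2 sqr_ge0.
rewrite y2 in Py.
set Y := \sum_i y i 0 ^+ 2 in Py.
have Y0 : 0 <= Y by apply: sumr_ge0 => i _; exact: sqr_ge0.
have tau0 : tau < 0 by lra.
pose V := E B (- tau) *m y.
have VY : \sum_i V i 0 ^+ 2 <= m * Y by apply: mulmx_sqr_le; exact: Em.
(* a straight segment in the coordinates carried by the flow, from E(-tau) y + x0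
   at the time t0 + tau to x0 at the time t0 *)
pose c s := E B (s - t0) *m (x0 + ((s - t0) / tau) *: V).
pose w s := E B (s - t0) *m (tau^-1 *: V).
have c0 : c t0 = x0 by rewrite /c subrr E0 mul0r scale0r addr0 mul1mx.
have c1 : c (t0 + tau) = y + E B tau *m x0.
  rewrite /c addrAC subrr add0r divff ?lt_eqF// scale1r mulmxDr addrC.
  by rewrite /V mulmxA E_inv mul1mx.
have dc (s : R) i : is_derive s 1 (fun r => c r i 0) ((w s - B *m c s) i 0).
  have dq l : is_derive s 1 (fun r : R => x0 l 0 + (r - t0) / tau * V l 0)
      (tau^-1 * V l 0).
    have d1 : is_derive s 1 (fun r : R => (r - t0) * (tau^-1 * V l 0)) (tau^-1 * V l 0).
      have := is_deriveM (is_derive_shift s 1 (- t0)) (is_derive_cst (tau^-1 * V l 0) s (1 : R)).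
      by rewrite scaler0 add0r [_ *: 1]mulr1.
    have -> : (fun r : R => x0 l 0 + (r - t0) / tau * V l 0) =
        cst (x0 l 0) + (fun r : R => (r - t0) * (tau^-1 * V l 0)).
      by apply/funext => r /=; rewrite -mulrA.
    by rewrite -[X in is_derive _ _ _ X]add0r; exact: is_deriveD.
  have H l := is_deriveM (is_derive_E_shift B i l t0 s) (dq l).
  have := is_derive_sum H; rewrite fct_sumE => K.
  have -> : (fun r => c r i 0) =
     (fun r => \sum_l E B (r - t0) i l * (x0 l 0 + (r - t0) / tau * V l 0)).
    by apply/funext => r; rewrite mxE; apply: eq_bigr => l _; rewrite !mxE.
  apply: is_derive_eq K _.
  rewrite big_split/= [RHS]mxE; congr (_ + _).
    by rewrite [RHS]mxE; apply: eq_bigr => l _; rewrite !mxE.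
  rewrite [RHS]mxE /c mulmxA [in RHS]mxE -sumrN.
  by apply: eq_bigr => l _; rewrite !mxE [LHS]mulrC mulNr.
have wY s : \sum_i w s i 0 ^+ 2 <= m ^+ 2 * (Y / tau ^+ 2).
  apply: le_trans (mulmx_sqr_le _ (Em _)) _.
  rewrite expr2 -mulrA ler_wpM2l//.
  under eq_bigr do rewrite mxE exprMn.
  rewrite -mulr_sumr mulrA mulrC exprVn ler_wpM2r// invr_ge0 sqr_ge0//.
have dk s := is_derive_curve (smooth_derivable sf)
  (fun j => smooth_continuous (smooth_d j sf)) (dc s).
have bound s : 2 * m ^+ 2 / tau <= 'd_None f (c s, s) +
    \sum_i (w s - B *m c s) i 0 * 'd_(Some i) f (c s, s).
  have -> : 'd_None f (c s, s) + \sum_i (w s - B *m c s) i 0 * 'd_(Some i) f (c s, s) =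
     transport B f (c s, s) + \sum_i w s i 0 * 'd_(Some i) f (c s, s).
    rewrite /transport -addrA; congr (_ + _); rewrite addrC -sumrB; apply: eq_bigr => i _.
    by rewrite mxE mulrDl; congr (_ + _); rewrite !mxE mulNr.
  have ll := log_laplacian_ge m1 Em sf eqf (c s, s).
  rewrite eqf.
  apply: (@le_trans _ _ (\sum_i (2^-1 * 'd_(Some i) f (c s, s) ^+ 2 +
      w s i 0 * 'd_(Some i) f (c s, s)))); last first.
    rewrite -subr_ge0 -big_split/= -sumrB.
    apply: (le_trans ll); rewrite le_eqVlt; apply/orP; left; apply/eqP.
    apply: eq_bigr => i _.
    move: ('d_(Some i) ('d_(Some i) f) _) ('d_(Some i) f _) (w s i 0) => *.
    by field.
  apply: (@le_trans _ _ (- 2^-1 * \sum_i w s i 0 ^+ 2)); last first.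
    rewrite mulr_sumr; apply: ler_sum => i _.
    move: ('d_(Some i) f _) (w s i 0) => a b.
    rewrite -subr_ge0 (_ : _ - _ = 2^-1 * (a + b) ^+ 2); last by field.
    by rewrite mulr_ge0 ?sqr_ge0.
  apply: (@le_trans _ _ (- 2^-1 * (m ^+ 2 * (Y / tau ^+ 2)))); last first.
    by rewrite ler_wnM2l// ?wY// oppr_le0.
  have -> : 2 * m ^+ 2 / tau = - 2^-1 * (m ^+ 2 * ((- 4 * tau) / tau ^+ 2)).
    by field; rewrite lt_eqF.
  rewrite ler_wnM2l ?oppr_le0// ler_wpM2l ?sqr_ge0// ler_wpM2r ?invr_ge0 ?sqr_ge0//.
  by lra.
have ltt : t0 + tau < t0 by rewrite gtrDl.
have [s _] := MVT ltt (fun s _ => dk s)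
  (derivable_within_continuous (fun s _ => @ex_derive _ _ _ _ _ _ _ (dk s))).
rewrite c0 c1 opprD addrA subrr add0r => Ek.
have := bound s; move: Ek; move: ('d_None f _ + _) => b Ek Hb.
have : b * - tau >= 2 * m ^+ 2 / tau * - tau by rewrite ler_wpM2r// oppr_ge0 ltW.
rewrite -Ek mulrN divfK ?lt_eqF//; lra.
Qed.

End harnack.


Theorem theorem1p4 (R : realType) (N : nat) (B : 'M[R]_N)
    (hB : (ereal_sup [set (opnorm (E B t))%:E | t in [set: R]] < +oo)%E) :
  exists C : R, 0 < C /\
    forall (z0 : 'cV[R]_N * R) (u : 'cV[R]_N * R -> R),
      smooth u ->
      (forall z, 0 <= u z) ->
      (forall z, opL B u z = 0) ->
      forall z, P_at B z0 z -> u z <= C * u z0.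
Proof.
have [m m1 Em] := E_frobenius hB.
exists (expR (2 * m ^+ 2)); split; first exact: expR_gt0.
move=> [x0 t0] u su u0 Lu _ [[y tau] Py <-]; rewrite /group_law/=.
set C := expR _; have C0 : 0 < C by exact: expR_gt0.
apply/ler_addgt0Pr => e e0; pose d := e / C.
have d0 : 0 < d by rewrite divr_gt0.
pose v (z : 'cV[R]_N * R) := u z + d.
have sv : smooth v by apply: smoothD => //; exact: smooth_cst.
have v0 z : 0 < v z by rewrite ltr_wpDl.
have dv j : 'd_j v = 'd_j u.
  rewrite /v (dD _ su (smooth_cst d)) d_cst.
  by apply/funext => z; rewrite addr0.
have Lv z : opL B v z = 0 by rewrite (opL_eq_d B z dv).
have := log_harnack m1 Em x0 t0 (smooth_ln v0 sv) (log_heat sv v0 Lv) Py.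
rewrite -ler_expR expRD !lnK ?posrE// /v -/C => H.
have -> : C * u (x0, t0) + e = (u (x0, t0) + d) * C.
  by rewrite mulrDl divfK ?gt_eqF// mulrC.
by apply: le_trans H; rewrite lerDl ltW.
Qed.
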